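(* Let $V\neq\{0\}$ be a Banach $\mathbb O$-bimodule and $T\in\mathscr B_{\mathcal{RO}}(V)$ power-associative. Then every $s\in\mathbb O$ with $|s|>\|T\|$ belongs to $\rho_*(T)$ (indeed to ${\rho_*}_J(T)$ for any $J$ with $s\in\mathbb C_J$), and for every $J\in\mathbb S$ the set ${\sigma_*}_J(T):=\mathbb C_J\setminus{\rho_*}_J(T)$ is a nonempty compact subset of $\mathbb C_J$.
   Context: $\mathbb O$ is the real octonion algebra with basis $e_0=1,\dots,e_7$, norm $|x|$; $\mathbb S=\{J\in\mathbb O:J^2=-1\}$, $\mathbb C_J=\mathbb R+\mathbb RJ$. An $\mathbb O$-bimodule is a real vector space $M$ with real-bilinear left and right multiplications by $\mathbb O$ (with $1x=x1=x$) whose associators $[p,q,x]=(pq)x-p(qx)$, $[p,x,q]=(px)q-p(xq)$, $[x,p,q]=(xp)q-x(pq)$ satisfy $[p,q,x]=[q,x,p]=[x,p,q]=-[q,p,x]$. Its real part is $\operatorname{Re}M=\{m: pm=mp,\ [p,q,m]=0\ \forall p,q\}$; $\operatorname{Re}x$ is the $e_0$-component in the unique decomposition $x=\sum e_ix_i$, $x_i\in\operatorname{Re}M$. A Banach $\mathbb O$-bimodule is one with a complete norm with $\|px\|=\|xp\|=|p|\|x\|$. $\mathscr B_{\mathbb R}(V)$: bounded real-linear operators; invertible means in $\mathscr B_{\mathbb R}(V)$; $R_sv=vs$. $\mathscr B_{\mathcal{RO}}(V)$: bounded real-linear $f$ with $\operatorname{Re}(f(x)p-f(xp))=0$ for all $p,x$.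 $T$ is power-associative if $T^n\in\mathscr B_{\mathcal{RO}}(V)$ for all $n$. $S$ is $\mathbb C_J$-liftable power associative if $\operatorname{Re}(S^n(v\lambda))=\operatorname{Re}(S^n(v)\lambda)$ for all $n\ge1,v\in V,\lambda\in\mathbb C_J$. ${\rho_*}_J(T)=\{s\in\mathbb C_J: R_s-T$ invertible and $(R_s-T)^{-1}$ $\mathbb C_J$-liftable power associative$\}$, $\rho_*(T)=\bigcup_J{\rho_*}_J(T)$, push-forward spectrum $\sigma_*(T)=\mathbb O\setminus\rho_*(T)$. *)

(* Defs.v *)
From HB Require Import structures.
From mathcomp Require Import all_boot all_order all_algebra.
From mathcomp Require Import all_classical all_reals all_analysis.
From Stdlib Require Import ClassicalEpsilon.
Set Implicit Arguments. Unset Strict Implicit. Unset Printing Implicit Defensive.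
Import Order.TTheory GRing.Theory Num.Theory.
Import numFieldNormedType.Exports.
Local Open Scope ring_scope.
Local Open Scope classical_set_scope.

(* The real octonions O = R^8 with basis e_0 = 1, e_1, ..., e_7.       *)
(* Multiplication table: e_i^2 = -1 (i>0), and e_i e_j = e_k for the  *)
(* cyclic orderings of the triples below (e_j e_i = -e_k).            *)
Definition oct_triples : seq (nat * nat * nat) :=
  [:: (1,2,3); (1,4,5); (1,7,6); (2,4,6); (2,5,7); (3,4,7); (3,6,5)]%N.

Definition oct_cyc (t : nat * nat * nat) : seq (nat * nat * nat) :=
  let: (a, b, c) := t in [:: (a, b, c); (b, c, a); (c, a, b)].

Definition oct_rots : seq (nat * nat * nat) := flatten (map oct_cyc oct_triples).

Definition oct_pos (i j : nat) : bool :=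
  has (fun t : nat * nat * nat => (t.1.1 == i) && (t.1.2 == j)) oct_rots.

Definition oct_third (i j : nat) : nat :=
  nth 0%N [seq t.2 | t <- oct_rots & (t.1.1 == i) && (t.1.2 == j)] 0.

(* index k such that e_i e_j = +- e_k *)
Definition oct_idx (i j : nat) : nat :=
  if i == 0%N then j else if j == 0%N then i else if i == j then 0%N
  else if oct_pos i j then oct_third i j else oct_third j i.

Section Octonions.
Variable R : realType.

Definition oct := 'rV[R]_8.

(* sign such that e_i e_j = oct_sgn i j * e_(oct_idx i j) *)
Definition oct_sgn (i j : nat) : R :=
  if i == 0%N then 1 else if j == 0%N then 1 else if i == j then -1
  else if oct_pos i j then 1 else -1.

Definition omul (x y : oct) : oct :=
  \row_(k < 8) \sum_(i < 8) \sum_(j < 8)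
     (if oct_idx i j == k then oct_sgn i j * x 0 i * y 0 j else 0).

Definition obasis (i : 'I_8) : oct := \row_(k < 8) (if k == i then 1 else 0).

Definition oone : oct := obasis ord0.

Definition onorm (x : oct) : R := Num.sqrt (\sum_(i < 8) x 0 i ^+ 2).

Definition oimag_units : set oct := [set J | omul J J = - oone].

Definition oCJ (J : oct) : set oct :=
  [set x | exists a b : R, x = a *: oone + b *: J].

End Octonions.

Section Bimodule.
Variable R : realType.
Variable V : completeNormedModType R.
Variable lm : oct R -> V -> V.
Variable rm : V -> oct R -> V.

Local Notation "p ** q" := (omul p q) (at level 40).

Definition assoc_ppx (p q : oct R) (x : V) : V := lm (p ** q) x - lm p (lm q x).
Definition assoc_pxp (p : oct R) (x : V) (q : oct R) : V := rm (lm p x) q - lm p (rm x q).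
Definition assoc_xpp (x : V) (p q : oct R) : V := rm (rm x p) q - rm x (p ** q).

Definition is_Obimodule : Prop :=
  (forall p : oct R, linear (lm p)) /\
  (forall x : V, linear (fun p : oct R => lm p x)) /\
  (forall p : oct R, linear (fun x : V => rm x p)) /\
  (forall x : V, linear (rm x)) /\
  (forall x : V, lm (oone R) x = x /\ rm x (oone R) = x) /\
  (forall (p q : oct R) (x : V),
     assoc_ppx p q x = assoc_pxp q x p /\
     assoc_pxp q x p = assoc_xpp x p q /\
     assoc_xpp x p q = - assoc_ppx q p x).

Definition is_BanachObimodule : Prop :=
  is_Obimodule /\
  (forall (p : oct R) (x : V),
     `|lm p x| = onorm p * `|x| /\ `|rm x p| = onorm p * `|x|).

Definition ReM : set V :=
  [set m | (forall p : oct R, lm p m = rm m p) /\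
           (forall p q : oct R, assoc_ppx p q m = 0)].

Definition is_decomp (x : V) (f : 'I_8 -> V) : Prop :=
  (forall i, ReM (f i)) /\ x = \sum_(i < 8) lm (obasis R i) (f i).

(* Re x = the e_0-component of the (unique) decomposition *)
Definition ReV (x : V) : V :=
  epsilon (inhabits (fun _ : 'I_8 => (0 : V))) (is_decomp x) ord0.

Definition bounded_op (f : V -> V) : Prop :=
  linear f /\ exists C : R, forall v : V, `|f v| <= C * `|v|.

Definition opnorm (f : V -> V) : R :=
  sup [set `|f v| | v in [set v : V | `|v| <= 1]].

Definition is_RO (f : V -> V) : Prop :=
  bounded_op f /\
  forall (p : oct R) (x : V), ReV (rm (f x) p - f (rm x p)) = 0.

Definition power_associative (T : V -> V) : Prop :=
  forall n : nat, is_RO (iter n T).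

Definition CJ_liftable_power_assoc (J : oct R) (S : V -> V) : Prop :=
  forall (n : nat), (1 <= n)%N ->
  forall (v : V) (lam : oct R), oCJ J lam ->
    ReV (iter n S (rm v lam)) = ReV (rm (iter n S v) lam).

Definition Rmul (s : oct R) : V -> V := fun v => rm v s.

Definition is_bounded_inverse (A S : V -> V) : Prop :=
  bounded_op S /\ (forall v, S (A v) = v) /\ (forall v, A (S v) = v).

Definition rhoJ (T : V -> V) (J : oct R) : set (oct R) :=
  [set s | oCJ J s /\
     exists S : V -> V,
       is_bounded_inverse (fun v => Rmul s v - T v) S /\
       CJ_liftable_power_assoc J S].

Definition rho_star (T : V -> V) : set (oct R) :=
  [set s | exists J, oimag_units J /\ rhoJ T J s].

Definition sigma_star (T : V -> V) : set (oct R) := ~` rho_star T.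

Definition sigmaJ (T : V -> V) (J : oct R) : set (oct R) :=
  oCJ J `\` rhoJ T J.

End Bimodule.

(* Main.v *)
(* Write L_p, R_p for left and right multiplication, e_0, ..., e_7 for the basis.
   Structure of V: for a line (a, b, c) of the Fano plane, t = L_a L_b L_c is an
   involution.  The bimodule identities force R_a + L_a to vanish on the range of
   1 + t, and hence t t' t'' = -1 for the three lines through a point.  So the
   projection onto the common (-1)-eigenspace of three non-concurrent lines lands
   in the eigenspace of all seven, which is Re V; this projection is x |-> Re x,
   and x is the sum of the e_i Re(conj(e_i) x).

   Spectrum: let I = R_J and P = Re.  An operator S is C_J-liftable power
   associative when P S^n I = P I S^n for all n.  Then S commutes with I modulo the
   closed subspace N(S) of all v such that P and P I vanish on every S^n v, and N(S)
   is stable under S and I.  Neumann perturbation of inverses preserves such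
   subspaces, which shows that the resolvent set is open in C_J and contains every
   s with |s| > ||T||.

   Nonemptiness: if all of C_J were resolvent, z |-> P ((R_z - T)^-1 v) would be
   harmonic and tend to 0 at infinity.  Its second-order expansion makes the mean of
   |P ((R_z - T)^-1 v)| over z + rho, z - rho, z + rho J, z - rho J at least the value
   at z, up to O(rho^3); this yields a maximum principle, hence P = 0 and V = 0. *)

Require Import Defs.
From HB Require Import structures.
From mathcomp Require Import all_boot all_order all_algebra.
From mathcomp Require Import all_classical all_reals all_analysis.
From mathcomp Require Import ring lra.
From Stdlib Require Import ClassicalEpsilon.
Import Order.TTheory GRing.Theory Num.Theory.
Import numFieldNormedType.Exports.
Local Open Scope ring_scope.
Local Open Scope classical_set_scope.

Set Implicit Arguments.
Unset Strict Implicit.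
Unset Printing Implicit Defensive.

(** * Linear combinations *)

Section ModuleExpressions.
Variables (K : comNzRingType) (M : lmodType K).

(** Syntax for a reflexive procedure: combinations of the same atoms agree as soon as their
    coefficients do, which leaves only identities in [K]. *)
Inductive mexpr :=
| MVar of nat | MZero | MAdd of mexpr & mexpr | MOpp of mexpr
| MScale of K & mexpr.

Fixpoint meval (env : seq M) (e : mexpr) : M :=
  match e with
  | MVar i => nth 0 env i
  | MZero => 0
  | MAdd e1 e2 => meval env e1 + meval env e2
  | MOpp e1 => - meval env e1
  | MScale c e1 => c *: meval env e1
  end.

Fixpoint mcoef (e : mexpr) (i : nat) : K :=
  match e with
  | MVar j => if j == i then 1 else 0
  | MZero => 0
  | MAdd e1 e2 => mcoef e1 i + mcoef e2 i
  | MOpp e1 => - mcoef e1 i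
  | MScale c e1 => c * mcoef e1 i
  end.

(** A nested conjunction, so that on a concrete environment [cbn] exposes one scalar goal per
    atom. *)
Fixpoint all_below (P : nat -> Prop) (n : nat) : Prop :=
  if n is m.+1 then P m /\ all_below P m else True.

Lemma mevalE env e :
  meval env e = \sum_(i < size env) mcoef e i *: nth 0 env i.
Proof.
elim: e => [j||e1 IH1 e2 IH2|e1 IH|c e1 IH] /=.
- have [lt_j|le_j] := ltnP j (size env).
    rewrite (bigD1 (Ordinal lt_j)) //= eqxx scale1r big1 ?addr0// => i ne_ij.
    case: eqP => [eq_ji|_]; last by rewrite scale0r.
    by case/eqP: ne_ij; apply: val_inj.
  rewrite nth_default // big1 // => i _; case: eqP => [eq_ji|_].
    by move: (ltn_ord i); rewrite -eq_ji ltnNge le_j.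
  by rewrite scale0r.
- by rewrite big1 // => i _; rewrite scale0r.
- by rewrite IH1 IH2 -big_split /=; apply: eq_bigr => i _; rewrite scalerDl.
- by rewrite IH -sumrN; apply: eq_bigr => i _; rewrite scaleNr.
- by rewrite IH scaler_sumr; apply: eq_bigr => i _; rewrite scalerA.
Qed.

Lemma meval_eq env e1 e2 :
  all_below (fun i => mcoef e1 i = mcoef e2 i) (size env) ->
  meval env e1 = meval env e2.
Proof.
move=> eq12; rewrite !mevalE; apply: eq_bigr => i _; congr (_ *: _).
move: (ltn_ord i); move: (nat_of_ord i) => k.
elim: (size env) eq12 => //= n IH [eqn eqs]; rewrite ltnS leq_eqVlt.
by case/orP => [/eqP -> //|]; exact: IH.
Qed.

End ModuleExpressions.

Ltac mexpr_mem x l :=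
  lazymatch l with
  | nil => constr:(false)
  | cons x _ => constr:(true)
  | cons _ ?l' => mexpr_mem x l'
  end.
Ltac mexpr_atoms t l :=
  lazymatch t with
  | GRing.add ?a ?b => let l1 := mexpr_atoms a l in mexpr_atoms b l1
  | GRing.opp ?a => mexpr_atoms a l
  | GRing.scale ?c ?a => mexpr_atoms a l
  | GRing.zero => l
  | _ => let b := mexpr_mem t l in
         lazymatch b with true => l | false => constr:(cons t l) end
  end.
Ltac mexpr_index x l :=
  lazymatch l with
  | cons x _ => constr:(O)
  | cons _ ?l' => let n := mexpr_index x l' in constr:(S n)
  end.
Ltac mexpr_reify K t l :=
  lazymatch t with
  | GRing.add ?a ?b => let e1 := mexpr_reify K a l in
                       let e2 := mexpr_reify K b l in
                       constr:(@MAdd K e1 e2)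
  | GRing.opp ?a => let e := mexpr_reify K a l in constr:(@MOpp K e)
  | GRing.scale ?c ?a => let e := mexpr_reify K a l in constr:(@MScale K c e)
  | GRing.zero => constr:(@MZero K)
  | _ => let n := mexpr_index t l in constr:(@MVar K n)
  end.

Ltac module_over K M :=
  match goal with |- ?a = ?b =>
    let l := mexpr_atoms a (@nil M) in
    let l' := mexpr_atoms b l in
    let e1 := mexpr_reify K a l' in
    let e2 := mexpr_reify K b l' in
    apply: (@meval_eq K M l' e1 e2); cbn;
    repeat split; first [done | ring | field]
  end.

Section LinearMaps.
Variables (K : comNzRingType) (U W : lmodType K) (f : U -> W).
Hypothesis f_lin : linear f.

Lemma lin0 : f 0 = 0.
Proof. by have := f_lin (-1) 0 0; rewrite scaler0 addr0 scaleN1r addNr. Qed.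

Lemma linD x y : f (x + y) = f x + f y.
Proof. by have := f_lin 1 x y; rewrite !scale1r. Qed.

Lemma linZ a x : f (a *: x) = a *: f x.
Proof. by have := f_lin a x 0; rewrite lin0 !addr0. Qed.

Lemma linN x : f (- x) = - f x.
Proof. by rewrite -scaleN1r linZ scaleN1r. Qed.

Lemma linB x y : f (x - y) = f x - f y.
Proof. by rewrite linD linN. Qed.

Lemma lin_sum n (F : 'I_n -> U) : f (\sum_i F i) = \sum_i f (F i).
Proof. exact: (big_morph f linD lin0). Qed.

End LinearMaps.

(** * Consequences of the bimodule axioms for lines of the Fano plane *)

Section BimoduleIdentities.
Variables (R : realType) (V : completeNormedModType R).
Variables (lm : oct R -> V -> V) (rm : V -> oct R -> V).
Hypothesis VO : is_Obimodule lm rm.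

Local Notation "p ** q" := (omul p q) (at level 40).
Local Notation one := (oone R).

Let lm_lin p : linear (lm p). Proof. by case: VO. Qed.
Let lml_lin x : linear (fun p : oct R => lm p x). Proof. by case: VO => _ []. Qed.
Let rm_lin p : linear (fun x => rm x p). Proof. by case: VO => _ [] _ []. Qed.
Let rmr_lin x : linear (rm x). Proof. by case: VO => _ [] _ [] _ []. Qed.

Lemma lm1 x : lm one x = x.
Proof. by case: VO => _ [] _ [] _ [] _ [] /(_ x)[]. Qed.
Lemma rm1 x : rm x one = x.
Proof. by case: VO => _ [] _ [] _ [] _ [] /(_ x)[]. Qed.

Definition lmD p := linD (lm_lin p).
Definition lmN p := linN (lm_lin p).
Definition lmB p := linB (lm_lin p).
Definition lmZ p := linZ (lm_lin p).
Definition rmD p := linD (rm_lin p).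
Definition rmB p := linB (rm_lin p).
Lemma lmNl p x : lm (- p) x = - lm p x. Proof. exact: linN (lml_lin x) p. Qed.
Lemma rmNr p x : rm x (- p) = - rm x p. Proof. exact: linN (rmr_lin x) p. Qed.

Lemma assocE p q x : [/\ assoc_pxp lm rm q x p = assoc_ppx lm p q x,
  assoc_xpp rm x p q = assoc_ppx lm p q x &
  assoc_ppx lm q p x = - assoc_ppx lm p q x].
Proof.
case: VO => _ [_ [_ [_ [_ /(_ p q x) [-> [-> ->]]]]]].
by split=> //; rewrite opprK.
Qed.

(** This and [rm_rm] are the rewriting rules that push right multiplications inward past left
    ones. *)
Lemma rm_lm p q x :
  rm (lm q x) p = lm q (rm x p) + lm (p ** q) x - lm p (lm q x).
Proof.
have [+ _ _] := assocE p q x; rewrite /assoc_pxp /assoc_ppx => /eqP.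
by rewrite subr_eq => /eqP ->; module_over R V.
Qed.

Lemma rm_rm p q x :
  rm (rm x p) q = rm x (p ** q) + lm (p ** q) x - lm p (lm q x).
Proof.
have [_ + _] := assocE p q x; rewrite /assoc_xpp /assoc_ppx => /eqP.
by rewrite subr_eq => /eqP ->; module_over R V.
Qed.

Lemma opp_eq0 (x : V) : x = - x -> x = 0.
Proof.
move=> /eqP; rewrite -addr_eq0 -{1 2}[x]scale1r -scalerDl scaler_eq0.
by case/orP => /eqP // two0; exfalso; lra.
Qed.

Lemma lm_anti p q x : p ** q = - (q ** p) -> lm p (lm q x) = - lm q (lm p x).
Proof.
move=> pq; have [_ _] := assocE p q x; rewrite /assoc_ppx pq lmNl => e.
by rewrite -[lm q (lm p x)](subKr (lm (q ** p) x)) e; module_over R V.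
Qed.

Lemma assoc_pp p x : assoc_ppx lm p p x = 0.
Proof. by have [_ _ /opp_eq0] := assocE p p x. Qed.

Lemma lm_sqr p x : p ** p = - one -> lm p (lm p x) = - x.
Proof.
move=> pp; have := assoc_pp p x; rewrite /assoc_ppx pp lmNl lm1 => /eqP.
by rewrite subr_eq0 => /eqP.
Qed.

Lemma rm_sqr p x : p ** p = - one -> rm (rm x p) p = - x.
Proof.
by move=> pp; rewrite rm_rm pp rmNr lmNl rm1 lm1 lm_sqr //; module_over R V.
Qed.

Definition anti (p q : oct R) := p ** q = - (q ** p).

(** With [one], the three elements multiply like the quaternion units. *)
Definition line (a b c : oct R) :=
  [/\ a ** b = c, b ** c = a & c ** a = b] /\
  [/\ b ** a = - c, c ** b = - a & a ** c = - b] /\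
  [/\ a ** a = - one, b ** b = - one & c ** c = - one].

Lemma anti_sym p q : anti p q -> anti q p.
Proof. by rewrite /anti => ->; rewrite opprK. Qed.

Lemma line_anti a b c : line a b c -> [/\ anti a b, anti b c & anti a c].
Proof.
rewrite /anti => -[[ab bc ca] [[ba cb ac] _]].
by rewrite ab ba bc cb ca ac !opprK.
Qed.

Lemma line_rot a b c : line a b c -> line b c a.
Proof. by case=> -[? ? ?] [[? ? ?] [? ? ?]]. Qed.

(** For a line and the regular bimodule, this is -1 on the quaternion subalgebra of the line and +1
    on its orthogonal complement. *)
Definition tri a b c (x : V) := lm a (lm b (lm c x)).

Lemma triD a b c x y : tri a b c (x + y) = tri a b c x + tri a b c y.
Proof. by rewrite /tri !lmD. Qed.
Lemma triN a b c x : tri a b c (- x) = - tri a b c x.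
Proof. by rewrite /tri !lmN. Qed.
Lemma triZ a b c s x : tri a b c (s *: x) = s *: tri a b c x.
Proof. by rewrite /tri !lmZ. Qed.

Lemma tri_rot a b c x : line a b c -> tri b c a x = tri a b c x.
Proof.
move=> /line_anti[ab _ ac]; rewrite /tri [lm c (lm a _)]lm_anti; last first.
  exact: anti_sym.
by rewrite lmN [in LHS]lm_anti ?opprK//; apply: anti_sym.
Qed.

(** Passing three anticommuting factors produces an odd number of signs; an element of the line
    itself passes only two, so it commutes with [tri]. *)
Lemma tri_lm_anti a b c p x : anti a p -> anti b p -> anti c p ->
  tri a b c (lm p x) = - lm p (tri a b c x).
Proof.
move=> ap bp cp; rewrite /tri (lm_anti _ cp) lmN (lm_anti _ bp) !lmN.
by rewrite (lm_anti _ ap) opprK.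
Qed.

Lemma tri_lm1 a b c x : line a b c -> tri a b c (lm a x) = lm a (tri a b c x).
Proof.
move=> /line_anti[/anti_sym ba _ /anti_sym ca].
by rewrite /tri (lm_anti _ ca) lmN (lm_anti _ ba) opprK.
Qed.

Lemma tri_lm2 a b c x : line a b c -> tri a b c (lm b x) = lm b (tri a b c x).
Proof. by move=> l; rewrite -!(tri_rot _ l) tri_lm1 //; exact: line_rot. Qed.

Lemma tri_lm3 a b c x : line a b c -> tri a b c (lm c x) = lm c (tri a b c x).
Proof.
move=> l; have l' := line_rot l; rewrite -!(tri_rot _ l) -!(tri_rot _ l').
by rewrite tri_lm1 //; exact: line_rot.
Qed.

(** After rotating the outer factor, the product is b c a a b c, and the squares collapse from the
    middle. *)
Lemma tri_invol a b c x : line a b c -> tri a b c (tri a b c x) = x.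
Proof.
move=> l; have [_ bc _] := line_anti l; rewrite -tri_rot // /tri.
case: l => _ [_ [aa bb cc]]; rewrite (lm_sqr _ aa) !lmN.
by rewrite [lm c (lm b _)](lm_anti _ (anti_sym bc)) lmN (lm_sqr _ bb) (lm_sqr _ cc) !opprK.
Qed.

(* On the regular bimodule [x + tri a b c x] is orthogonal to the quaternions
   spanned by the line, hence anticommutes with [a]. *)
Lemma rm_tri a b c x : line a b c ->
  rm (x + tri a b c x) a = - lm a (x + tri a b c x).
Proof.
move=> l; have [ab bc ac] := line_anti l.
(* The claim is [key] at y = - c x, where c y - a (b y) becomes x + [tri a b c x]. *)
have key y : rm (lm c y - lm a (lm b y)) a = - (lm b y + lm a (lm c y)).
  case: l => -[eab ebc eca] [[eba ecb eac] [aa bb cc]].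
  have La z : lm a (lm a z) = - z by exact: lm_sqr.
  (* [E1] and [E2] evaluate ((a y) a) b in two ways; their comparison [E3] expresses c (y a). *)
  have E1 : rm (rm (lm a y) a) b =
      lm a (rm (rm y a) b) - lm c (rm y a) + lm a (lm b (rm y a)).
    rewrite (rm_lm a a) aa lmNl lm1 La opprK addrNK.
    by rewrite (rm_lm b a) eba lmNl (lm_anti _ (anti_sym ab)) opprK.
  have E2 : rm (rm (lm a y) a) b = lm a (rm y c).
    rewrite (rm_rm a b) eab (rm_lm c a) eca.
    rewrite [lm b (lm a y)]lm_anti; last exact: anti_sym.
    by rewrite lmN La; module_over R V.
  have E3 : lm c (rm y a) = lm a (lm b (rm y a)) + lm b y + lm a (lm c y).
    apply/(addIr (lm a (rm y c))); rewrite -{1}E2 E1 (rm_rm a b) eab.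
    by rewrite lmB lmD La; module_over R V.
  rewrite rmB (rm_lm a c) eac (rm_lm a a) aa (rm_lm a b) eab !lmNl !lmB !lmD lm1.
  by rewrite !La E3; module_over R V.
have [aa cc] : a ** a = - one /\ c ** c = - one by case: l => _ [_ []].
have := key (- lm c x); rewrite !lmN (lm_sqr _ cc) lmN opprK -/(tri a b c x).
by rewrite opprK => ->; rewrite lmD (lm_sqr _ aa) opprK; module_over R V.
Qed.

(** Let [W] be 1 plus the product of the three involutions; it commutes with left multiplication by
    b and d. Since R_a + L_a changes sign under each involution, it vanishes on the range of [W].
    This forces [tri a d e] to be the identity there, whereas L_b preserves the range and
    anticommutes with [tri a d e]; hence [W] is 0. *)
Lemma tri_mono3 a b c d e f g x :
  line a b c -> line a d e -> line a f g ->
  anti b d -> anti b e -> anti b f -> anti b g -> anti c d -> anti c e ->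
  anti c f -> anti c g -> anti d f -> anti d g -> anti e f -> anti e g ->
  tri a b c (tri a d e (tri a f g x)) = - x.
Proof.
move=> l1 l2 l3 bd be bf bg cd ce cf cg df dg ef eg.
have [ab bc ac] := line_anti l1; have [ad de ae] := line_anti l2.
have [af fg ag] := line_anti l3.
pose W y := y + tri a b c (tri a d e (tri a f g y)).
have Wlmb y : lm b (W y) = W (lm b y).
  rewrite /W (@tri_lm_anti a f g b); try exact: anti_sym; last by [].
  rewrite triN (@tri_lm_anti a d e b); try exact: anti_sym; last by [].
  by rewrite opprK (tri_lm2 _ l1) lmD.
have Wlmd y : lm d (W y) = W (lm d y).
  rewrite /W (@tri_lm_anti a f g d); try exact: anti_sym; last by [].
  by rewrite triN (tri_lm2 _ l2) triN (@tri_lm_anti a b c d) // opprK lmD.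
have Wrm y : rm (W y) a = - lm a (W y).
  pose u z := rm z a + lm a z.
  have u_tri p q z : line a p q -> u (tri a p q z) = - u z.
    move=> l; have := rm_tri z l; rewrite /u rmD lmD => /eqP.
    rewrite -subr_eq0 => /eqP e0; apply/eqP; rewrite -subr_eq0 -e0.
    by apply/eqP; module_over R V.
  have uW : u (W y) = 0.
    have -> : u (W y) = u y + u (tri a b c (tri a d e (tri a f g y))).
      by rewrite /u /W rmD lmD; module_over R V.
    by rewrite !u_tri // !opprK subrr.
  by apply/eqP; rewrite -addr_eq0; apply/eqP.
(* Expanding (d (W y)) a by [rm_lm] and comparing with [Wrm] at d y gives e (W y) = d (a (W y)). *)
have We y : tri a d e (W y) = W y.
  have := Wrm (lm d y); rewrite -Wlmd (rm_lm a d) Wrm.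
  have [[-> _ _] [_ [aa dd _]]] := l2.
  rewrite lmN => /eqP; rewrite -subr_eq0 => /eqP e0.
  have -> : tri a d e (W y) = lm a (lm d (lm d (lm a (W y)))).
    rewrite /tri; congr (lm a (lm d _)); apply/eqP; rewrite -subr_eq0 -e0.
    by apply/eqP; module_over R V.
  by rewrite (lm_sqr _ dd) lmN (lm_sqr _ aa) opprK.
have W0 : W x = 0.
  have bb : b ** b = - one by case: l1 => _ [_ []].
  have := We (lm b x); rewrite -Wlmb (@tri_lm_anti a d e b); try exact: anti_sym; last by [].
  by rewrite We => /esym/opp_eq0 b0; rewrite -[W x]opprK -(lm_sqr (W x) bb) b0 (lin0 (lm_lin b)) oppr0.
by apply/eqP; rewrite -addr_eq0 addrC; apply/eqP.
Qed.

Lemma tri_third a b c d e f g x :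
  line a b c -> line a d e -> line a f g ->
  anti b d -> anti b e -> anti b f -> anti b g -> anti c d -> anti c e ->
  anti c f -> anti c g -> anti d f -> anti d g -> anti e f -> anti e g ->
  tri a b c x = - x -> tri a d e x = - x -> tri a f g x = - x.
Proof.
move=> l1 l2 l3 bd be bf bg cd ce cf cg df dg ef eg t1 t2.
have /(congr1 (tri a b c)) := tri_mono3 x l1 l2 l3 bd be bf bg cd ce cf cg df dg ef eg.
rewrite tri_invol // triN t1 opprK => /(congr1 (tri a d e)).
by rewrite tri_invol // t2.
Qed.

Lemma tri_lm_lm a b c x : line a b c -> tri a b c x = - x ->
  lm a (lm b x) = lm c x.
Proof.
move=> l; have cc : c ** c = - one by case: l => _ [_ []].
have l' := line_rot (line_rot l); rewrite (tri_rot _ l') => /(congr1 (lm c)).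
by rewrite /tri (lm_sqr _ cc) lmN => /oppr_inj.
Qed.

(** The shared point a commutes with [tri a b c], while d and e each contribute one sign. *)
Lemma tri_comm a b c d e x :
  line a b c -> line a d e -> anti b d -> anti b e -> anti c d -> anti c e ->
  tri a b c (tri a d e x) = tri a d e (tri a b c x).
Proof.
move=> l1 l2 bd be cd ce; have [ab bc ac] := line_anti l1; have [ad de ae] := line_anti l2.
rewrite {2}/tri (tri_lm1 _ l1) (@tri_lm_anti a b c d) //.
by rewrite (@tri_lm_anti a b c e) // !lmN opprK.
Qed.

(** The associator of p, q and m l is s m when evaluated as [p, q, m l] and m s when evaluated as
    [m l, p, q]; the axioms equate the two. *)
Lemma nuclear_central m : (forall p q, assoc_ppx lm p q m = 0) ->
  forall l p q, let s := (l ** p) ** q - l ** (p ** q) in lm s m = rm m s.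
Proof.
move=> m0.
have Lm p q : lm (p ** q) m = lm p (lm q m).
  by apply/eqP; rewrite -subr_eq0; apply/eqP; apply: m0.
have LRm p q : rm (lm q m) p = lm q (rm m p).
  by have [+ _ _] := assocE p q m; rewrite m0 => /eqP; rewrite subr_eq0 => /eqP.
have Rm p q : rm (rm m p) q = rm m (p ** q).
  by have [_ + _] := assocE p q m; rewrite m0 => /eqP; rewrite subr_eq0 => /eqP.
move=> l p q s.
have E1 : assoc_ppx lm p q (rm m l) = lm s m.
  have [_ _ _] := assocE p q m.
  rewrite /s (linB (lml_lin m)).
  have -> : assoc_ppx lm p q (rm m l) = assoc_pxp lm rm p (lm q m) l.
    by rewrite /assoc_ppx /assoc_pxp -!LRm Lm.
  have [-> _ _] := assocE l p (lm q m).
  by rewrite /assoc_ppx -!Lm.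
rewrite -E1; have [_ <- _] := assocE p q (rm m l).
by rewrite /assoc_xpp !Rm /s (linB (rmr_lin m)).
Qed.

End BimoduleIdentities.

(** * Octonions *)

Section OctonionBasis.
Variable R : realType.

Local Notation "p ** q" := (omul p q) (at level 40).
Local Notation one := (oone R).

(** Indexed by [nat] to match the multiplication table; [inord] sends indices from 8 on to
    [ord0]. *)
Definition oct_e (n : nat) : oct R := obasis R (inord n).

Local Notation e := oct_e.

Lemma oct_e0 : e 0 = one.
Proof. by congr obasis; apply/val_inj; rewrite /= inordK. Qed.

Lemma omulDZl a x y z : omul (a *: x + y) z = a *: omul x z + omul y z :> oct R.
Proof.
apply/rowP => k; rewrite !mxE mulr_sumr -big_split; apply: eq_bigr => i _.
rewrite mulr_sumr -big_split; apply: eq_bigr => j _ /=; rewrite !mxE.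
by case: ifP => _; ring.
Qed.

Lemma omulDZr a x y z : omul z (a *: x + y) = a *: omul z x + omul z y :> oct R.
Proof.
apply/rowP => k; rewrite !mxE mulr_sumr -big_split; apply: eq_bigr => i _.
rewrite mulr_sumr -big_split; apply: eq_bigr => j _ /=; rewrite !mxE.
by case: ifP => _; ring.
Qed.

Lemma oct_expand (p : oct R) : p = \sum_(i < 8) p 0 i *: e i.
Proof.
apply/rowP => k; rewrite summxE (bigD1 k) //= !mxE inord_val eqxx mulr1.
rewrite big1 ?addr0 // => i; rewrite !mxE inord_val eq_sym => /negPf ->.
by rewrite mulr0.
Qed.

Lemma oct_idx_lt (i j : 'I_8) : (oct_idx i j < 8)%N.
Proof. by case: i => [[|[|[|[|[|[|[|[|i]]]]]]]] //= _]; case: j => [[|[|[|[|[|[|[|[|j]]]]]]]] //= _]. Qed.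

Lemma omul_e i j : (i < 8)%N -> (j < 8)%N ->
  e i ** e j = oct_sgn R i j *: e (oct_idx i j).
Proof.
move=> lt_i lt_j; apply/rowP => k; rewrite !mxE.
rewrite (bigD1 (inord i)) //= [X in _ + X]big1 ?addr0; last first.
  move=> i' ne; rewrite big1 // => j' _; rewrite !mxE (negPf ne).
  by case: ifP => _; ring.
rewrite (bigD1 (inord j)) //= [X in _ + X]big1 ?addr0; last first.
  move=> j' ne; rewrite !mxE (negPf ne); by case: ifP => _; ring.
have := oct_idx_lt (Ordinal lt_i) (Ordinal lt_j); rewrite /= => lt_ij.
rewrite !mxE !eqxx !inordK // -val_eqE /= inordK // eq_sym.
by case: ifP => _; ring.
Qed.

Lemma line_e a b c : (a, b, c) \in oct_rots -> line (e a) (e b) (e c).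
Proof.
pose pos i j k := [&& (i < 8)%N, (j < 8)%N, oct_idx i j == k, i != 0%N,
  j != 0%N, i != j, oct_pos i j, oct_idx j i == k & ~~ oct_pos j i].
pose chk (t : nat * nat * nat) :=
  let: (i, j, k) := t in [&& pos i j k, pos j k i & pos k i j].
(* The 21 oriented triples are checked by computation. *)
have /allP all_chk : all chk oct_rots by [].
have posP i j k : pos i j k ->
    [/\ e i ** e j = e k, e j ** e i = - e k & e i ** e i = - one].
  case/and5P => lti ltj /eqP ij i0 /and5P [j0 ne_ij pij /eqP ji pji].
  rewrite !omul_e // ij ji /oct_sgn /oct_idx (negPf i0) (negPf j0).
  rewrite [j == i]eq_sym (negPf ne_ij) pij (negPf pji) eqxx oct_e0.
  by rewrite scale1r !scaleN1r.
by move=> /all_chk /and3P [/posP[? ? ?] /posP[? ? ?] /posP[? ? ?]].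
Qed.

Lemma oct_table_sym (i j : 'I_8) : i != 0%N :> nat -> j != 0%N :> nat ->
  i != j :> nat ->
  oct_idx j i = oct_idx i j /\ oct_pos j i = ~~ oct_pos i j.
Proof.
move=> i0 j0 ij.
suff /andP[/eqP ? /eqP ?] :
  (oct_idx j i == oct_idx i j) && (oct_pos j i == ~~ oct_pos i j) by [].
move: i0 j0 ij.
by case: i => [[|[|[|[|[|[|[|[|i]]]]]]]] //= _];
   case: j => [[|[|[|[|[|[|[|[|j]]]]]]]] //= _].
Qed.

Lemma oct_sgn_opp (i j : 'I_8) : i != 0%N :> nat -> j != 0%N :> nat ->
  i != j :> nat -> oct_sgn R j i = - oct_sgn R i j.
Proof.
move=> i0 j0 ij; have [_ pji] := oct_table_sym i0 j0 ij.
rewrite /oct_sgn (negPf i0) (negPf j0) [_ == nat_of_ord i]eq_sym (negPf ij) pji.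
by case: oct_pos; rewrite ?opprK.
Qed.

Lemma anti_e a b : (0 < a < 8)%N -> (0 < b < 8)%N -> a != b -> anti (e a) (e b).
Proof.
move=> /andP[a0 lta] /andP[b0 ltb] ab; rewrite /anti !omul_e //.
pose i := Ordinal lta; pose j := Ordinal ltb.
have i0 : i != 0%N :> nat by rewrite -lt0n.
have j0 : j != 0%N :> nat by rewrite -lt0n.
have [/= -> _] := oct_table_sym i0 j0 ab.
by have /= -> := oct_sgn_opp i0 j0 ab; rewrite scaleNr opprK.
Qed.

(** Symmetrised structure constants: distinct imaginary units anticommute, so only products with
    [e 0] and squares survive. *)
Lemma oct_sgn_sym (i j k : 'I_8) :
  (if oct_idx i j == k then oct_sgn R i j else 0) +
  (if oct_idx j i == k then oct_sgn R j i else 0) =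
  2 * (if (i == ord0) && (j == k) then 1 else 0) +
  2 * (if (j == ord0) && (i == k) then 1 else 0) -
  2 * (if (i == j) && (k == ord0) then 1 else 0).
Proof.
rewrite -!val_eqE /=.
case: (eqVneq (i : nat) 0%N) => [i0|i0].
  case: (eqVneq (j : nat) 0%N) => [j0|j0].
    rewrite /oct_sgn /oct_idx i0 j0 !eqxx /= [_ == nat_of_ord k]eq_sym.
    by case: ifP => _; ring.
  rewrite /oct_sgn /oct_idx i0 eqxx (negPf j0) [0%N == nat_of_ord j]eq_sym (negPf j0) /=.
  by case: ifP => _; ring.
case: (eqVneq (j : nat) 0%N) => [j0|j0].
  rewrite /oct_sgn /oct_idx j0 eqxx (negPf i0) /=.
  by case: ifP => _; ring.
case: (eqVneq (i : nat) (j : nat)) => [ij|ij] /=.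
  rewrite /oct_sgn /oct_idx ij (negPf j0) eqxx [0%N == _]eq_sym.
  by case: ifP => _; ring.
have [-> _] := oct_table_sym i0 j0 ij; rewrite (oct_sgn_opp i0 j0 ij).
by case: ifP => _; ring.
Qed.

(** The quadratic equation of an octonion. Doubling the defining double sum and exchanging its
    indices brings in the constants of [oct_sgn_sym]. *)
Lemma omul_self (x : oct R) :
  x ** x = (2 * x 0 ord0) *: x - (\sum_(i < 8) x 0 i ^+ 2) *: one.
Proof.
have if_comb (b1 b2 : bool) (s1 s2 y z : R) :
    (if b1 then s1 * y * z else 0) + (if b2 then s2 * z * y else 0) =
    ((if b1 then s1 else 0) + (if b2 then s2 else 0)) * (y * z).
  by case: b1; case: b2; ring.
have dist (A B C y : R) :
    (2 * A + 2 * B - 2 * C) * y = 2 * (A * y) + 2 * (B * y) - 2 * (C * y) by ring.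
have delta2 (F : 'I_8 -> 'I_8 -> R) (a b : 'I_8) :
    \sum_(i < 8) \sum_(j < 8) (if (i == a) && (j == b) then 1 else 0) * F i j = F a b.
  rewrite (bigD1 a) //= [X in _ + X]big1 ?addr0 => [|i /negPf ->]; last first.
    by rewrite big1 // => j _; rewrite mul0r.
  rewrite (bigD1 b) //= [X in _ + X]big1 ?addr0 => [|i /negPf ->]; last first.
    by rewrite andbF mul0r.
  by rewrite !eqxx mul1r.
apply/rowP => k; apply: (@mulfI _ 2) => //; rewrite !mxE.
rewrite mulr_natl mulr2n {2}exchange_big -big_split /=.
transitivity (2 * (\sum_(i < 8) \sum_(j < 8) (if (i == ord0) && (j == k) then 1 else 0) * (x 0 i * x 0 j))
  + 2 * (\sum_(i < 8) \sum_(j < 8) (if (j == ord0) && (i == k) then 1 else 0) * (x 0 i * x 0 j))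
  - 2 * (\sum_(i < 8) \sum_(j < 8) (if (i == j) && (k == ord0) then 1 else 0) * (x 0 i * x 0 j))).
  rewrite !mulr_sumr -sumrN -!big_split; apply: eq_bigr => i _ /=.
  rewrite !mulr_sumr -sumrN -!big_split; apply: eq_bigr => j _ /=.
  transitivity (((if oct_idx i j == k then oct_sgn R i j else 0) +
      (if oct_idx j i == k then oct_sgn R j i else 0)) * (x 0 i * x 0 j)).
    exact: if_comb.
  by rewrite oct_sgn_sym; exact: dist.
rewrite delta2 [X in _ + 2 * X - _]exchange_big.
rewrite (delta2 (fun i j => x 0 j * x 0 i)).
have -> : \sum_(i < 8) \sum_(j < 8) (if (i == j) && (k == ord0) then 1 else 0) * (x 0 i * x 0 j)
   = (\sum_(i < 8) x 0 i ^+ 2) * (if k == ord0 then 1 else 0).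
  rewrite mulr_suml; apply: eq_bigr => i _.
  rewrite (bigD1 i) //= [X in _ + X]big1 ?addr0 => [|j]; last first.
    by rewrite eq_sym => /negPf ->; rewrite mul0r.
  by rewrite eqxx /=; ring.
have fin (a b c : R) : 2 * (a * b) + 2 * (b * a) - 2 * c = 2 * (2 * a * b - c).
  by ring.
exact: fin.
Qed.

(** In the quadratic equation a nonzero real component would force [J] to be real, hence a real
    number of square -1. *)
Lemma omul_unitP (J : oct R) : oimag_units J ->
  J 0 ord0 = 0 /\ \sum_(i < 8) J 0 i ^+ 2 = 1.
Proof.
rewrite /oimag_units /= omul_self => JJ.
have Jk k : 2 * J 0 ord0 * J 0 k - (\sum_(i < 8) J 0 i ^+ 2) * (k == ord0)%:R
    = - (k == ord0)%:R.
  by have /rowP/(_ k) := JJ; rewrite !mxE; case: eqP.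
have J0 : J 0 ord0 = 0.
  apply/eqP/negP => /negP J0.
  have Jk0 k : k != ord0 -> J 0 k = 0.
    move=> /negPf k0; have := Jk k; rewrite k0 mulr0 subr0 oppr0 => /eqP.
    by rewrite !mulf_eq0 (negPf J0) pnatr_eq0 /= => /eqP.
  have := Jk ord0; rewrite eqxx (bigD1 ord0) //= big1 => [|k /Jk0 ->]; last first.
    by rewrite expr0n.
  by have : 0 < J 0 ord0 ^+ 2; [rewrite exprn_even_gt0|nra].
by split=> //; have := Jk ord0; rewrite eqxx J0 !mulr0 add0r mulr1 => /oppr_inj.
Qed.

Lemma onorm_CJ (J : oct R) a b : oimag_units J ->
  onorm (a *: one + b *: J) = Num.sqrt (a ^+ 2 + b ^+ 2).
Proof.
move=> /omul_unitP [J0 J1]; congr Num.sqrt.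
rewrite (eq_bigr (fun i => a ^+ 2 * (if i == ord0 then 1 else 0) + b ^+ 2 * J 0 i ^+ 2)).
  rewrite big_split -!mulr_sumr J1 /= (bigD1 ord0) //= big1 ?addr0 ?mulr1 //.
  by move=> i /negPf ->.
by move=> i _; rewrite !mxE; case: eqP => [->|_]; rewrite ?J0; ring.
Qed.

Lemma oct_in_CJ (s : oct R) : exists2 J, oimag_units J & oCJ J s.
Proof.
pose y : oct R := s - s 0 ord0 *: one.
have y0 : y 0 ord0 = 0 by rewrite !mxE eqxx mulr1 subrr.
pose r := \sum_(i < 8) y 0 i ^+ 2.
have r_ge0 : 0 <= r by apply: sumr_ge0 => i _; exact: sqr_ge0.
have yy : y ** y = - r *: one by rewrite omul_self y0 mulr0 scale0r add0r scaleNr.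
have [r0|rn0] := eqVneq r 0.
  (* A real [s] lies in every C_J, so any imaginary unit serves. *)
  exists (e 1); first by rewrite /oimag_units /= omul_e // /oct_sgn /oct_idx /= oct_e0 scaleN1r.
  exists (s 0 ord0), 0; rewrite scale0r addr0; apply/eqP; rewrite -subr_eq0 -/y.
  apply/eqP/rowP => i; rewrite [RHS]mxE; apply/eqP; rewrite -sqrf_eq0; apply/eqP.
  by apply: (psumr_eq0P (P := xpredT) (F := fun i => y 0 i ^+ 2)) => // j _; exact: sqr_ge0.
have sr : Num.sqrt r ^+ 2 = r by rewrite sqr_sqrtr.
have sr0 : Num.sqrt r != 0 by rewrite sqrtr_eq0 -ltNge lt_neqAle eq_sym rn0.
(* Otherwise J is the normalised imaginary part of [s]. *)
exists ((Num.sqrt r)^-1 *: y).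
  rewrite /oimag_units /=.
  have := omulDZl (Num.sqrt r)^-1 y 0 ((Num.sqrt r)^-1 *: y); rewrite addr0 => ->.
  have := omulDZr (Num.sqrt r)^-1 y 0 y; rewrite addr0 => ->.
  have -> : omul 0 ((Num.sqrt r)^-1 *: y) = 0 :> oct R.
    by have := omulDZl (-1) 0 0 ((Num.sqrt r)^-1 *: y); rewrite scaler0 addr0 scaleN1r addNr.
  have -> : omul y 0 = 0 :> oct R.
    by have := omulDZr (-1) 0 0 y; rewrite scaler0 addr0 scaleN1r addNr.
  have E (q : R) : q != 0 -> q^-1 * (q^-1 * - q ^+ 2) = -1.
    by move=> q0; field.
  by rewrite !addr0 yy !scalerA -mulrA; have := E _ sr0; rewrite sr => ->; rewrite scaleN1r.
exists (s 0 ord0), (Num.sqrt r); rewrite scalerA mulfV // scale1r /y.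
by rewrite addrC subrK.
Qed.

End OctonionBasis.

(** * The real part of a bimodule *)

Section RealPart.
Variables (R : realType) (V : completeNormedModType R).
Variables (lm : oct R -> V -> V) (rm : V -> oct R -> V).
Hypothesis VO : is_Obimodule lm rm.

Local Notation "p ** q" := (omul p q) (at level 40).
Local Notation one := (oone R).
Local Notation e := (oct_e R).
Local Notation t1 := (tri lm (e 1) (e 2) (e 3)).
Local Notation t2 := (tri lm (e 1) (e 4) (e 5)).
Local Notation t3 := (tri lm (e 2) (e 4) (e 6)).

Lemma comm12 x : t1 (t2 x) = t2 (t1 x).
Proof. by apply: (tri_comm VO); (exact: line_e || exact: anti_e). Qed.

Lemma comm13 x : t1 (t3 x) = t3 (t1 x).
Proof.
rewrite -!(tri_rot VO _ (@line_e R 1 2 3 isT)).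
by apply: (tri_comm VO); (exact: line_e || exact: anti_e).
Qed.

Lemma comm23 x : t2 (t3 x) = t3 (t2 x).
Proof.
rewrite -!(tri_rot VO _ (@line_e R 1 4 5 isT)) -!(tri_rot VO _ (@line_e R 2 4 6 isT)).
by apply: (tri_comm VO); (exact: line_e || exact: anti_e).
Qed.

(* The product of the projections (1 - t) / 2 for the three non-concurrent lines
   (1,2,3), (1,4,5), (2,4,6). *)
Definition re_proj x := 8^-1 *: (x - t1 x - t2 x - t3 x + t1 (t2 x) + t1 (t3 x)
  + t2 (t3 x) - t1 (t2 (t3 x))).

Local Notation Rp := re_proj.

(** Equivalent to membership in [ReM], by [Rnuclear_ReM] and [ReM_Rnuclear]. *)
Definition Rnuclear m := [/\ t1 m = - m, t2 m = - m & t3 m = - m].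

Lemma Rp_nuclear x : Rnuclear (Rp x).
Proof.
have inv1 y : t1 (t1 y) = y by apply: (tri_invol VO); exact: line_e.
have inv2 y : t2 (t2 y) = y by apply: (tri_invol VO); exact: line_e.
have inv3 y : t3 (t3 y) = y by apply: (tri_invol VO); exact: line_e.
split; rewrite /re_proj (triZ VO) !(triD VO, triN VO).
- by rewrite !inv1; module_over R V.
- by rewrite -!comm12 !inv2; module_over R V.
- by rewrite -!comm13 -!comm23 -?comm13 !inv3; module_over R V.
Qed.

(** Each of the four other lines is the third one through a point whose first two lines are settled:
    the points 1, 2, 4 and 6 are taken in turn, with [tri_third]. *)
Lemma Rnuclear_tri m : Rnuclear m ->
  forall a b c, (a, b, c) \in oct_rots -> tri lm (e a) (e b) (e c) m = - m.
Proof.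
case=> m1 m2 m3.
have m176 : tri lm (e 1) (e 7) (e 6) m = - m.
  by apply: (tri_third VO) m1 m2; (exact: line_e || exact: anti_e).
have m257 : tri lm (e 2) (e 5) (e 7) m = - m.
  apply: (tri_third VO (b := e 3) (c := e 1)) m3; try (exact: line_e || exact: anti_e).
  exact: etrans (tri_rot VO _ (@line_e R 1 2 3 isT)) m1.
have m347 : tri lm (e 3) (e 4) (e 7) m = - m.
  rewrite -(tri_rot VO _ (@line_e R 3 4 7 isT)).
  apply: (tri_third VO (b := e 5) (c := e 1) (d := e 6) (e := e 2)); try (exact: line_e || exact: anti_e).
    exact: etrans (tri_rot VO _ (@line_e R 1 4 5 isT)) m2.
  exact: etrans (tri_rot VO _ (@line_e R 2 4 6 isT)) m3.
have m365 : tri lm (e 3) (e 6) (e 5) m = - m.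
  rewrite -(tri_rot VO _ (@line_e R 3 6 5 isT)).
  apply: (tri_third VO (b := e 1) (c := e 7) (d := e 2) (e := e 4)); try (exact: line_e || exact: anti_e).
    by rewrite (tri_rot VO _ (@line_e R 7 6 1 isT)) (tri_rot VO _ (@line_e R 1 7 6 isT)).
  by rewrite (tri_rot VO _ (@line_e R 4 6 2 isT)) (tri_rot VO _ (@line_e R 2 4 6 isT)).
have triples a b c : (a, b, c) \in oct_triples -> tri lm (e a) (e b) (e c) m = - m.
  rewrite !inE.
  by do 6?[case/orP => [/eqP[-> -> ->] //|]]; case/eqP=> -> -> ->.
move=> a b c abc.
have [[[a' b'] c'] t_in] := flatten_mapP abc.
have l : line (e a') (e b') (e c').
  by apply: line_e; apply/flatten_mapP; exists (a', b', c') => //; rewrite inE eqxx.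
rewrite !inE => /or3P[] /eqP[-> -> ->]; first exact: triples.
  by rewrite (tri_rot VO _ l) triples.
by rewrite (tri_rot VO _ (line_rot l)) (tri_rot VO _ l) triples.
Qed.

Let lml_lin x : linear (fun p : oct R => lm p x). Proof. by case: VO => _ []. Qed.
Let rmr_lin x : linear (rm x). Proof. by case: VO => _ [] _ [] _ []. Qed.
Let lm_lin p : linear (lm p). Proof. by case: VO. Qed.

Lemma assoc_linl q m : linear (fun p => assoc_ppx lm p q m).
Proof.
move=> a p p'; rewrite /assoc_ppx omulDZl (lml_lin m) (lml_lin (lm q m)).
by module_over R V.
Qed.

Lemma assoc_linr p m : linear (fun q => assoc_ppx lm p q m).
Proof.
by move=> a q q'; rewrite /assoc_ppx omulDZr !(lml_lin m) lm_lin; module_over R V.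
Qed.

Lemma assoc_e0 m : (forall i j : 'I_8, assoc_ppx lm (e i) (e j) m = 0) ->
  forall p q, assoc_ppx lm p q m = 0.
Proof.
move=> m0 p q; rewrite (oct_expand p) (lin_sum (assoc_linl q m)) big1 // => i _.
rewrite (linZ (assoc_linl q m)) (oct_expand q) (lin_sum (assoc_linr _ m)).
rewrite big1 ?scaler0 // => j _.
by rewrite (linZ (assoc_linr _ m)) m0 scaler0.
Qed.

Lemma Rnuclear_assoc m : Rnuclear m -> forall p q, assoc_ppx lm p q m = 0.
Proof.
move=> mN; apply: assoc_e0 => i j.
have pos (a b c : nat) : (a, b, c) \in oct_rots -> assoc_ppx lm (e a) (e b) m = 0.
  move=> abc; have l := @line_e R _ _ _ abc; have [[ab _ _] _] := l.
  by rewrite /assoc_ppx ab (tri_lm_lm VO l) ?subrr //; exact: Rnuclear_tri.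
have [i0|i0] := eqVneq (i : nat) 0%N.
  rewrite i0 /assoc_ppx omul_e // /oct_sgn /oct_idx eqxx scale1r oct_e0.
  by rewrite (lm1 VO) subrr.
have [j0|j0] := eqVneq (j : nat) 0%N.
  rewrite j0 /assoc_ppx omul_e // /oct_sgn /oct_idx (negPf i0) eqxx scale1r oct_e0.
  by rewrite (lm1 VO) subrr.
have [ij|ij] := eqVneq (i : nat) (j : nat).
  by rewrite ij (assoc_pp VO).
(* Two distinct imaginary units lie on one line, in one of its two orientations; the reversed one
   follows by antisymmetry. *)
have : ((nat_of_ord i, nat_of_ord j, oct_idx i j) \in oct_rots) ||
       ((nat_of_ord j, nat_of_ord i, oct_idx i j) \in oct_rots).
  move: i0 j0 ij.
  by case: i => [[|[|[|[|[|[|[|[|i]]]]]]]] //= _];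
     case: j => [[|[|[|[|[|[|[|[|j]]]]]]]] //= _].
case/orP => /pos // aij.
by have [_ _ ->] := assocE VO (e j) (e i) m; rewrite aij oppr0.
Qed.

(** Vanishing associators imply commutation: every imaginary unit is half an octonion associator,
    and [nuclear_central] applies to those. *)
Lemma Rnuclear_ReM m : Rnuclear m -> Defs.ReM lm rm m.
Proof.
move=> mN; have m0 := Rnuclear_assoc mN; split=> //.
have double_inj (x y : V) : x + x = y + y -> x = y.
  move=> xy; apply/eqP; rewrite -subr_eq0; apply/eqP.
  transitivity (2^-1 *: ((x + x) - (y + y))); first by module_over R V.
  by rewrite xy subrr scaler0.
(* Under these incidences (e_a e_b) e_d = e_i and e_a (e_b e_d) = - e_i, so the associator is 2
   e_i. *)
have comm (i a b d c f : nat) : (a, b, c) \in oct_rots -> (c, d, i) \in oct_rots ->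
    (b, d, f) \in oct_rots -> (f, a, i) \in oct_rots -> lm (e i) m = rm m (e i).
  move=> /(@line_e R)[[ab _ _] _] /(@line_e R)[[cd _ _] _].
  move=> /(@line_e R)[[bd _ _] _] /(@line_e R)[_ [[af _ _] _]].
  have := nuclear_central VO m0 (e a) (e b) (e d).
  rewrite /= ab cd bd af opprK (linD (lml_lin m)) (linD (rmr_lin m)).
  exact: double_inj.
have comm_e (i : 'I_8) : lm (e i) m = rm m (e i).
  case: i => [[|[|[|[|[|[|[|[|i]]]]]]]] //= _].
  - by rewrite oct_e0 (lm1 VO) (rm1 VO).
  - exact: (comm 1 3 4 6 7 2)%N.
  - exact: (comm 2 1 4 7 5 3)%N.
  - exact: (comm 3 2 4 5 6 1)%N.
  - exact: (comm 4 1 7 2 6 5)%N.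
  - exact: (comm 5 2 3 4 1 7)%N.
  - exact: (comm 6 3 1 4 2 5)%N.
  - exact: (comm 7 1 2 4 3 6)%N.
move=> p; rewrite (oct_expand p) (lin_sum (lml_lin m)) (lin_sum (rmr_lin m)).
by apply: eq_bigr => i _; rewrite (linZ (lml_lin m)) (linZ (rmr_lin m)) comm_e.
Qed.

Lemma ReM_Rnuclear m : Defs.ReM lm rm m -> Rnuclear m.
Proof.
case=> _ m0.
have triN a b c : (a, b, c) \in oct_rots -> tri lm (e a) (e b) (e c) m = - m.
  move=> /(@line_e R)[[_ bc _] [_ [aa _ _]]]; rewrite /tri.
  have /eqP := m0 (e b) (e c); rewrite subr_eq0 bc => /eqP <-.
  exact: lm_sqr VO _ _ aa.
by split; exact: triN.
Qed.

Definition tri_sgn (p : oct R) (c1 c2 c3 : R) := forall y : V,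
  [/\ t1 (lm p y) = c1 *: lm p (t1 y), t2 (lm p y) = c2 *: lm p (t2 y) &
      t3 (lm p y) = c3 *: lm p (t3 y)].

Lemma Rp_lm p c1 c2 c3 x : tri_sgn p c1 c2 c3 ->
  Rp (lm p x) = 8^-1 *: (lm p x - c1 *: lm p (t1 x) - c2 *: lm p (t2 x)
   - c3 *: lm p (t3 x) + (c1 * c2) *: lm p (t1 (t2 x))
   + (c1 * c3) *: lm p (t1 (t3 x)) + (c2 * c3) *: lm p (t2 (t3 x))
   - (c1 * c2 * c3) *: lm p (t1 (t2 (t3 x)))).
Proof.
move=> psgn; rewrite /re_proj.
have p1 y : t1 (lm p y) = c1 *: lm p (t1 y) by case: (psgn y).
have p2 y : t2 (lm p y) = c2 *: lm p (t2 y) by case: (psgn y).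
have p3 y : t3 (lm p y) = c3 *: lm p (t3 y) by case: (psgn y).
rewrite p3 p2 !(triZ VO) p2 !p1 !(triZ VO) p1.
by module_over R V.
Qed.

(** The imaginary units realise each nontrivial sign pattern once, so their left multiplications
    carry Re V onto the other seven joint eigenspaces of the three involutions. *)
Lemma tri_sgn_e : [/\ tri_sgn (e 1) 1 1 (-1), tri_sgn (e 2) 1 (-1) 1,
  tri_sgn (e 3) 1 (-1) (-1) & tri_sgn (e 4) (-1) 1 1] /\
  [/\ tri_sgn (e 5) (-1) 1 (-1), tri_sgn (e 6) (-1) (-1) 1 &
  tri_sgn (e 7) (-1) (-1) (-1)].
Proof.
split; split=> y; rewrite ?scale1r ?scaleN1r; split.
all: try by apply: (tri_lm_anti VO); exact: anti_e.
all: try by apply: (tri_lm1 VO); exact: line_e.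
all: try by apply: (tri_lm2 VO); exact: line_e.
all: by apply: (tri_lm3 VO); exact: line_e.
Qed.

End RealPart.

(** * The eight real components of a vector *)

Section RealPartDecomposition.
Variables (R : realType) (V : completeNormedModType R).
Variables (lm : oct R -> V -> V) (rm : V -> oct R -> V).
Hypothesis VO : is_Obimodule lm rm.

Local Notation "p ** q" := (omul p q) (at level 40).
Local Notation one := (oone R).
Local Notation e := (oct_e R).
Local Notation t1 := (tri lm (e 1) (e 2) (e 3)).
Local Notation t2 := (tri lm (e 1) (e 4) (e 5)).
Local Notation t3 := (tri lm (e 2) (e 4) (e 6)).
Local Notation Rp := (re_proj lm).

Let lm_lin p : linear (lm p). Proof. by case: VO. Qed.

Lemma Rp_lin : linear Rp.
Proof.
move=> a x y; rewrite /re_proj !(triD VO, triZ VO); module_over R V.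
Qed.

(** Conjugation by L_p turns [Rp] into the projection onto the joint eigenspace with eigenvalues
    -c1, -c2, -c3. *)
Lemma lm_Rp_lm p c1 c2 c3 x : p ** p = - one -> tri_sgn lm p c1 c2 c3 ->
  lm p (Rp (- lm p x)) = 8^-1 *: (x - c1 *: t1 x - c2 *: t2 x - c3 *: t3 x
   + (c1 * c2) *: t1 (t2 x) + (c1 * c3) *: t1 (t3 x) + (c2 * c3) *: t2 (t3 x)
   - (c1 * c2 * c3) *: t1 (t2 (t3 x))).
Proof.
move=> pp psgn; rewrite (linN Rp_lin) (Rp_lm VO _ psgn) (linN (lm_lin p)).
rewrite !(linD (lm_lin p), linN (lm_lin p), linZ (lm_lin p)) !(lm_sqr VO _ pp).
by module_over R V.
Qed.

Lemma e_sqr i : (0 < i < 8)%N -> e i ** e i = - one.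
Proof.
case/andP; rewrite lt0n => i0 lti; rewrite omul_e // /oct_sgn /oct_idx.
by rewrite (negPf i0) eqxx scaleN1r oct_e0.
Qed.

Lemma sum8 (F : nat -> V) :
  \sum_(i < 8) F i = F 0%N + F 1%N + F 2%N + F 3%N + F 4%N + F 5%N + F 6%N + F 7%N.
Proof. by rewrite !big_ord_recr big_ord0 /= add0r. Qed.

Definition Rcoord (x : V) (i : nat) : V :=
  if i == 0%N then Rp x else Rp (- lm (e i) x).

(** The eight conjugated projections add up to the identity: by orthogonality of sign patterns every
    nontrivial product of involutions cancels. *)
Lemma Rcoord_sum x : x = \sum_(i < 8) lm (obasis R i) (Rcoord x i).
Proof.
under eq_bigr do rewrite -[X in obasis R X]inord_val -/(e _).
rewrite (sum8 (fun i => lm (e i) (Rcoord x i))) /Rcoord /= oct_e0 (lm1 VO).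
have [[s1 s2 s3 s4] [s5 s6 s7]] := tri_sgn_e VO.
rewrite (lm_Rp_lm _ (@e_sqr 1 isT) s1) (lm_Rp_lm _ (@e_sqr 2 isT) s2).
rewrite (lm_Rp_lm _ (@e_sqr 3 isT) s3) (lm_Rp_lm _ (@e_sqr 4 isT) s4).
rewrite (lm_Rp_lm _ (@e_sqr 5 isT) s5) (lm_Rp_lm _ (@e_sqr 6 isT) s6).
rewrite (lm_Rp_lm _ (@e_sqr 7 isT) s7) /re_proj.
by module_over R V.
Qed.

Lemma Rp_id m : Rnuclear lm m -> Rp m = m.
Proof.
move=> [m1 m2 m3]; rewrite /re_proj m3 m2 m1 !(triN VO) m2 (triN VO) m1.
by module_over R V.
Qed.

(** On e_i m the projection is the scalar (1 + c1) (1 + c2) (1 + c3) / 8, and some sign is -1. *)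
Lemma Rp_e i m : (0 < i < 8)%N -> Rnuclear lm m -> Rp (lm (e i) m) = 0.
Proof.
move=> i_range [m1 m2 m3].
have Rp0 c1 c2 c3 : (1 + c1) * (1 + c2) * (1 + c3) = 0 ->
    tri_sgn lm (e i) c1 c2 c3 -> Rp (lm (e i) m) = 0.
  move=> c0 /(Rp_lm VO) ->; rewrite m3 m2 !(triN VO) m2 m1 !(triN VO) m1.
  rewrite !(linN (lm_lin (e i))); set y := lm (e i) m.
  transitivity ((8^-1 * ((1 + c1) * (1 + c2) * (1 + c3))) *: y).
    by module_over R V.
  by rewrite c0 mulr0 scale0r.
have [[s1 s2 s3 s4] [s5 s6 s7]] := tri_sgn_e VO.
case: i i_range Rp0 => [|[|[|[|[|[|[|[|i]]]]]]]] //= _ Rp0.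
- by apply: Rp0 s1; ring.
- by apply: Rp0 s2; ring.
- by apply: Rp0 s3; ring.
- by apply: Rp0 s4; ring.
- by apply: Rp0 s5; ring.
- by apply: Rp0 s6; ring.
- by apply: Rp0 s7; ring.
Qed.

Lemma Rp_decomp x f : is_decomp lm rm x f -> Rp x = f ord0.
Proof.
case=> fRe ->; rewrite (lin_sum Rp_lin) (bigD1 ord0) //= big1 ?addr0.
  rewrite (_ : obasis R ord0 = one) // (lm1 VO) Rp_id //.
  exact: (ReM_Rnuclear VO).
move=> i i0; rewrite -[X in obasis R X]inord_val -/(e _) Rp_e //.
  by rewrite ltn_ord andbT lt0n.
exact: (ReM_Rnuclear VO).
Qed.

(** [Rcoord] provides a decomposition, so the choice by [epsilon] is a genuine one, and [Rp_decomp]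
    fixes its first component. *)
Lemma ReV_Rp x : Defs.ReV lm rm x = Rp x.
Proof.
rewrite /Defs.ReV; apply/esym/Rp_decomp.
apply: (epsilon_spec _ (is_decomp lm rm x)).
exists (fun i => Rcoord x i); split; last exact: Rcoord_sum.
move=> i; rewrite /Rcoord; case: ifP => _;
  by apply: (Rnuclear_ReM VO); exact: (Rp_nuclear VO).
Qed.

Lemma Rp_trivial : (forall x, Rp x = 0) -> forall x : V, x = 0.
Proof.
move=> Rp0 x; rewrite [LHS]Rcoord_sum big1 // => i _; rewrite /Rcoord.
by case: ifP => _; rewrite Rp0 (lin0 (lm_lin _)).
Qed.

Lemma Rp_bounded : is_BanachObimodule lm rm -> exists2 C, 0 <= C & forall x, `|Rp x| <= C * `|x|.
Proof.
case=> _ norm_lm.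
have tri_bnd a b c : exists2 C, 0 <= C & forall x, `|tri lm a b c x| <= C * `|x|.
  exists (onorm a * (onorm b * onorm c)).
    by rewrite !mulr_ge0 // sqrtr_ge0.
  move=> x; rewrite /tri; have [-> _] := norm_lm a (lm b (lm c x)).
  by have [-> _] := norm_lm b (lm c x); have [-> _] := norm_lm c x; rewrite !mulrA.
have [C1 C10 H1] := tri_bnd (e 1) (e 2) (e 3).
have [C2 C20 H2] := tri_bnd (e 1) (e 4) (e 5).
have [C3 C30 H3] := tri_bnd (e 2) (e 4) (e 6).
have comp C D (f g : V -> V) : 0 <= C -> (forall x, `|f x| <= C * `|x|) ->
    (forall x, `|g x| <= D * `|x|) -> forall x, `|f (g x)| <= C * D * `|x|.
  by move=> C0 Hf Hg x; rewrite (le_trans (Hf _)) // -mulrA ler_wpM2l.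
exists (8^-1 * (1 + C1 + C2 + C3 + C1 * C2 + C1 * C3 + C2 * C3 + C1 * (C2 * C3))).
  by rewrite mulr_ge0 // !addr_ge0 // ?mulr_ge0.
move=> x; rewrite normrZ ger0_norm // -mulrA ler_wpM2l //.
have add A B (a b : V) : `|a| <= A * `|x| -> `|b| <= B * `|x| -> `|a + b| <= (A + B) * `|x|.
  by move=> ? ?; rewrite mulrDl (le_trans (ler_normD _ _)) // lerD.
have sub A B (a b : V) : `|a| <= A * `|x| -> `|b| <= B * `|x| -> `|a - b| <= (A + B) * `|x|.
  by move=> ? ?; apply: add => //; rewrite normrN.
have H12 := comp _ _ t1 t2 C10 H1 H2; have H13 := comp _ _ t1 t3 C10 H1 H3.
have H23 := comp _ _ t2 t3 C20 H2 H3.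
have H123 := comp _ _ t1 (t2 \o t3) C10 H1 H23.
have H0 : `|x| <= 1 * `|x| by rewrite mul1r.
have := sub _ _ _ _ (sub _ _ _ _ (sub _ _ _ _ H0 (H1 x)) (H2 x)) (H3 x).
move/add/(_ (H12 x))/add/(_ (H13 x))/add/(_ (H23 x))/sub/(_ (H123 x)); exact.
Qed.

End RealPartDecomposition.

(** * Perturbation of inverses *)

Section ClosedSubspaces.
Variables (R : realType) (V : completeNormedModType R).
Implicit Types (N : set V) (f E S : V -> V).

Definition closed_subspace N :=
  [/\ closed N, N 0 & forall a x y, N x -> N y -> N (a *: x + y)].

Lemma subspaceZ N a x : closed_subspace N -> N x -> N (a *: x).
Proof. by case=> _ N0 NZD Nx; rewrite -[_ *: _]addr0; exact: NZD. Qed.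

Lemma subspaceD N x y : closed_subspace N -> N x -> N y -> N (x + y).
Proof. by case=> _ _ NZD Nx Ny; rewrite -[x]scale1r; exact: NZD. Qed.

Lemma subspaceN N x : closed_subspace N -> N x -> N (- x).
Proof. by move=> NS Nx; rewrite -scaleN1r; exact: subspaceZ. Qed.

(** The map x -> v - E x is a contraction of the closed set [N] into itself, so its Banach fixed
    point already lies in [N]. *)
Lemma neumann N E (q : R) v : closed_subspace N -> linear E ->
  0 <= q < 1 -> (forall x, `|E x| <= q * `|x|) ->
  (forall x, N x -> N (E x)) -> N v -> exists2 x, N x & x + E x = v.
Proof.
move=> NS E_lin /andP[q0 q1] Eq NE Nv.
pose f x := v - E x.
have fN : {homo f : x / N x >-> N x}.
  by move=> x Nx; apply: subspaceD => //; apply: subspaceN => //; exact: NE.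
have [cN N0 _] := NS.
have [||p Np pE] := @banach_fixed_point R V N (mkfun_fun fN) _ cN.
- exists (NngNum q0); split=> //= -[x y] _ /=.
  rewrite /mkfun /f (_ : _ - _ = - E (x - y)); last first.
    by rewrite (linB E_lin); module_over R V.
  by rewrite normrN.
- by exists 0.
exists p => //; rewrite {1}pE /= /mkfun /f subrK //.
Qed.

Lemma bounded_op_gt0 f : bounded_op f ->
  exists2 C, 0 < C & forall v, `|f v| <= C * `|v|.
Proof.
case=> _ [C fC]; exists (`|C| + 1); first by rewrite ltr_wpDl.
move=> v; apply: (le_trans (fC v)); rewrite ler_wpM2r //.
by rewrite (le_trans (ler_norm _)) // lerDl.
Qed.

(** The equation (A0 + D) x = v is equivalent to x + S0 (D x) = S0 v, solved by [neumann]. Its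
    solution is unique, so the one found inside [N] is [S v]; this is how the new inverse inherits
    invariant subspaces. *)
Lemma perturb_inverse A0 S0 D (c d : R) :
  linear A0 -> linear D -> is_bounded_inverse A0 S0 -> 0 <= c -> 0 <= d ->
  (forall x, `|S0 x| <= c * `|x|) -> (forall x, `|D x| <= d * `|x|) -> c * d < 1 ->
  exists2 S, is_bounded_inverse (fun v => A0 v + D v) S &
    forall N, closed_subspace N -> (forall x, N x -> N (S0 (D x))) ->
      forall v, N (S0 v) -> N (S v).
Proof.
move=> A0_lin D_lin [S0_b [S0A A0S]] c0 d0 S0c Dd cd1.
have [S0_lin _] := S0_b.
pose E x := S0 (D x).
have E_lin : linear E by move=> a x y; rewrite /E D_lin S0_lin.
have Ecd x : `|E x| <= c * d * `|x|.
  by rewrite (le_trans (S0c _)) // -mulrA ler_wpM2l.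
have cd : 0 <= c * d < 1 by rewrite mulr_ge0.
have setT_sub : closed_subspace [set: V] by split=> //; exact: closedT.
have E_inj x : x + E x = 0 -> x = 0.
  move=> /eqP; rewrite addr_eq0 => /eqP xE; apply/eqP; rewrite -normr_le0.
  have : `|x| <= c * d * `|x| by rewrite {1}xE normrN.
  have := normr_ge0 x; move: cd => /andP[]; nra.
have AE x v : A0 x + D x = v <-> x + E x = S0 v.
  split=> [<-|e]; first by rewrite (linD S0_lin) S0A.
  by rewrite -[RHS]A0S -e (linD A0_lin) /E A0S.
have ex v : {x | x + E x = S0 v}.
  apply: constructive_indefinite_description.
  by have [//|x _ xE] := neumann (v := S0 v) setT_sub E_lin cd Ecd (fun _ _ => I); exists x.
pose S v := sval (ex v).
have SE v : S v + E (S v) = S0 v := svalP (ex v).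
have E_unique x y : x + E x = y + E y -> x = y.
  move=> xy; apply/eqP; rewrite -subr_eq0; apply/eqP/E_inj.
  rewrite (linB E_lin); apply: etrans (_ : (x + E x) - (y + E y) = 0).
    by module_over R V.
  by rewrite xy subrr.
exists S; last first.
  move=> N NS NE v NS0v.
  have [x Nx xE] := neumann NS E_lin cd Ecd NE NS0v.
  by rewrite (E_unique (S v) x) // SE xE.
split; last split.
- split.
    move=> a x y; apply: E_unique; rewrite SE S0_lin -!SE E_lin.
    by module_over R V.
  (* From S v + E (S v) = S0 v one gets (1 - c d) |S v| <= c |v|. *)
  exists (c / (1 - c * d)) => v; rewrite mulrAC ler_pdivlMr; last by lra.
  have := S0c v; rewrite -SE => h.
  have : `|S v| <= `|S v + E (S v)| + `|E (S v)|.
    by rewrite -{1}[S v](addrK (E (S v))) ler_normB.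
  have := Ecd (S v); have := normr_ge0 (S v); have := normr_ge0 v; nra.
- by move=> v; apply: E_unique; rewrite SE; apply/esym/AE.
- by move=> v; apply/AE; rewrite SE.
Qed.

End ClosedSubspaces.

(** * Operators commuting with I modulo a subspace *)

Section CommutingModuloReal.
Variables (R : realType) (V : completeNormedModType R) (I P : V -> V) (CP : R).
Hypothesis I_lin : linear I.
Hypothesis II : forall x, I (I x) = - x.
Hypothesis P_lin : linear P.
Hypothesis P_bnd : forall x, `|P x| <= CP * `|x|.
Hypothesis CP_ge0 : 0 <= CP.
Hypothesis I_norm :
  forall a b x, `|a *: x + b *: I x| = Num.sqrt (a ^+ 2 + b ^+ 2) * `|x|.

(** Liftability tested at J alone; the case n = 0 holds trivially, and [CJ_liftableP] recovers all
    of C_J by linearity. *)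
Definition liftable (S : V -> V) :=
  forall n v, P (iter n S (I v)) = P (I (iter n S v)).

(* The largest closed [S]-invariant subspace on which both real components
   [P v] and [P (I v)] vanish: modulo it a liftable [S] commutes with [I]. *)
Definition hidden (S : V -> V) : set V :=
  [set v | forall n, P (iter n S v) = 0 /\ P (I (iter n S v)) = 0].

Lemma I_isom x : `|I x| = `|x|.
Proof.
by have := I_norm 0 1 x; rewrite scale0r add0r scale1r expr0n expr1n add0r sqrtr1 mul1r.
Qed.

Lemma iter_lin (S : V -> V) n : linear S -> linear (iter n S).
Proof. by move=> S_lin; elim: n => [//|n IH] a x y; rewrite !iterS IH S_lin. Qed.

Lemma iter_bnd (S : V -> V) n : bounded_op S -> exists C, forall x, `|iter n S x| <= C * `|x|.
Proof.
case/bounded_op_gt0 => C C0 SC; elim: n => [|n [D IH]].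
  by exists 1 => x; rewrite mul1r.
by exists (C * D) => x; rewrite iterS (le_trans (SC _)) // -mulrA ler_wpM2l // ltW.
Qed.

Lemma hidden_subspace (S : V -> V) : bounded_op S -> closed_subspace (hidden S).
Proof.
move=> S_b; have [S_lin _] := S_b; split.
- move=> v vcl n.
  have [C SC] := iter_bnd n S_b.
  (* A bounded linear map that vanishes on [hidden S] vanishes on its closure. *)
  have zero (g : V -> V) D : linear g -> (forall x, `|g x| <= D * `|x|) ->
      (forall x, hidden S x -> g x = 0) -> g v = 0.
    move=> g_lin gD g0; apply/eqP; rewrite -normr_le0; apply/ler_addgt0Pl => e e0; rewrite addr0.
    have De : 0 < `|D| + 1 by rewrite ltr_wpDl.
    have [w [Nw]] := vcl _ (nbhsx_ballx v (e / (`|D| + 1)) (divr_gt0 e0 De)).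
    rewrite -ball_normE /= => vw.
    rewrite -(subr0 (g v)) -(g0 _ Nw) -(linB g_lin) (le_trans (gD _)) //.
    move: vw; rewrite ltr_pdivlMr // => vw.
    have := ler_norm D; have := normr_ge0 (v - w); nra.
  split.
    apply: (zero (fun y => P (iter n S y)) (CP * C)) => [a x y|x|x /(_ n)[]//].
      by rewrite iter_lin // P_lin.
    by rewrite (le_trans (P_bnd _)) // -mulrA ler_wpM2l.
  apply: (zero (fun y => P (I (iter n S y))) (CP * C)) => [a x y|x|x /(_ n)[]//].
    by rewrite iter_lin // I_lin P_lin.
  by rewrite (le_trans (P_bnd _)) // -mulrA ler_wpM2l // I_isom.
- by move=> n; rewrite (lin0 (iter_lin n S_lin)) (lin0 I_lin) (lin0 P_lin).
- move=> a x y Nx Ny n; have [Nx1 Nx2] := Nx n; have [Ny1 Ny2] := Ny n.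
  rewrite iter_lin // I_lin !P_lin Nx1 Nx2 Ny1 Ny2.
  by rewrite scaler0 addr0.
Qed.

Lemma hidden_stable (S : V -> V) v : hidden S v -> hidden S (S v).
Proof. by move=> Nv n; rewrite -iterSr; exact: Nv. Qed.

(** Liftability exchanges the two vanishing conditions, since I^2 = -1. *)
Lemma hidden_I (S : V -> V) v : linear S -> liftable S -> hidden S v -> hidden S (I v).
Proof.
move=> S_lin SI Nv n; have [N1 N2] := Nv n; split; first by rewrite SI.
by rewrite -SI II (linN (iter_lin n S_lin)) (linN P_lin) N1 oppr0.
Qed.

(** Both P S^n S I v and P S^n I S v equal P I S^(n+1) v; the condition with P I reduces to the same
    comparison through I^2 = -1. *)
Lemma hidden_comm (S : V -> V) v : linear S -> liftable S -> hidden S (S (I v) - I (S v)).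
Proof.
move=> S_lin SI n; have nl := iter_lin n S_lin; split.
  rewrite (linB nl) (linB P_lin) [X in _ - X]SI -!iterSr.
  by rewrite (SI n.+1) subrr.
rewrite -SI (linB I_lin) (linB nl) (linB P_lin) II (linN nl) (linN P_lin) opprK.
rewrite [X in X + _]SI -!iterSr -(SI n.+1) II.
by rewrite (linN (iter_lin n.+1 S_lin)) (linN P_lin) addNr.
Qed.

(** Converse of [hidden_comm]: by telescoping, S^n I - I S^n has its values in [N]. *)
Lemma liftable_from N (S : V -> V) : closed_subspace N -> linear S ->
  (forall v, N v -> P v = 0) -> (forall v, N v -> N (S v)) ->
  (forall v, N (S (I v) - I (S v))) -> liftable S.
Proof.
move=> NS S_lin NP S_N SI n v; apply/eqP; rewrite -subr_eq0 -(linB P_lin).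
apply/eqP/NP; elim: n => [|n IH]; first by rewrite subrr; case: NS.
rewrite !iterS (_ : _ - _ = S (iter n S (I v) - I (iter n S v)) +
  (S (I (iter n S v)) - I (S (iter n S v)))); last first.
  by rewrite (linB S_lin); module_over R V.
by apply: subspaceD => //; exact: S_N.
Qed.

End CommutingModuloReal.

(** * Resolvent set: large parameters and openness *)

Section Resolvent.
Variables (R : realType) (V : completeNormedModType R) (I P T : V -> V) (CP tau : R).
Hypothesis I_lin : linear I.
Hypothesis II : forall x, I (I x) = - x.
Hypothesis I_norm :
  forall a b x, `|a *: x + b *: I x| = Num.sqrt (a ^+ 2 + b ^+ 2) * `|x|.
Hypothesis P_lin : linear P.
Hypothesis CP_ge0 : 0 <= CP.
Hypothesis P_bnd : forall x, `|P x| <= CP * `|x|.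
Hypothesis T_lin : linear T.
Hypothesis tau_ge0 : 0 <= tau.
Hypothesis T_bnd : forall x, `|T x| <= tau * `|x|.
Hypothesis T_lift : liftable I P T.

Local Notation hidden := (hidden I P).
Local Notation liftable := (liftable I P).

Definition complex_scale (a b : R) (x : V) := a *: x + b *: I x.

Definition resolvent a b S := is_bounded_inverse (fun v => complex_scale a b v - T v) S.

Definition resolvent_set a b := exists2 S, resolvent a b S & liftable S.

Lemma cscale_lin a b : linear (complex_scale a b).
Proof. by move=> c x y; rewrite /complex_scale I_lin; module_over R V. Qed.

Lemma cscaleI a b x : complex_scale a b (I x) = I (complex_scale a b x).
Proof. by rewrite /complex_scale (linD I_lin) !(linZ I_lin). Qed.

Lemma cscale_bnd a b x : `|complex_scale a b x| <= (`|a| + `|b|) * `|x|.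
Proof.
by rewrite (le_trans (ler_normD _ _)) // !normrZ (I_isom I_norm) mulrDl.
Qed.

Lemma hidden_cscale S a b v : bounded_op S -> liftable S ->
  hidden S v -> hidden S (complex_scale a b v).
Proof.
move=> S_b SI Nv; have [S_lin _] := S_b.
have NS := hidden_subspace I_lin P_lin P_bnd CP_ge0 I_norm S_b.
apply: (subspaceD NS); apply: (subspaceZ _ NS) => //.
exact: (hidden_I II P_lin S_lin SI).
Qed.

Lemma resolvent_lin a b S : resolvent a b S -> linear S.
Proof. by case=> [[]]. Qed.

(** For S inverse to A this is S I - I S = S (I A - A I) S, which moves the commutator from the
    inverse to A. *)
Lemma resolvent_comm a b S v : resolvent a b S ->
  S (I v) - I (S v) = S (I (complex_scale a b (S v) - T (S v)) - (complex_scale a b (I (S v)) - T (I (S v)))).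
Proof.
move=> SR; have [_ [SA AS]] := SR; rewrite (linB (resolvent_lin SR)) SA.
by congr (S (I _) - _); rewrite AS.
Qed.

Lemma hidden_P S v : hidden S v -> P v = 0.
Proof. by move=> /(_ 0%N)[]. Qed.

(** Multiplication by z = a + b J has inverse [S0], multiplication by the conjugate of z over |z|^2,
    of norm 1/|z|; it is perturbed by -T. Both [S0] and T preserve [hidden T], so the resolvent does
    too, and modulo it the resolvent commutes with I because T does. *)
Lemma resolvent_large a b : tau ^+ 2 < a ^+ 2 + b ^+ 2 -> resolvent_set a b.
Proof.
move=> tau_lt; pose r := Num.sqrt (a ^+ 2 + b ^+ 2).
have r2 : r ^+ 2 = a ^+ 2 + b ^+ 2 by rewrite sqr_sqrtr // addr_ge0 ?sqr_ge0.
have r_ge0 : 0 <= r by exact: sqrtr_ge0.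
have tau_r : tau < r by rewrite -(ltr_pXn2r (n := 2)) ?nnegrE // r2.
have r_gt0 : 0 < r by exact: le_lt_trans tau_r.
have ab0 : a ^+ 2 + b ^+ 2 != 0 by rewrite -r2 expf_neq0 // gt_eqF.
pose s := (a ^+ 2 + b ^+ 2)^-1.
pose S0 := complex_scale (s * a) (s * - b).
have S0_lin : linear S0 by exact: cscale_lin.
have S0_norm x : `|S0 x| = r^-1 * `|x|.
  rewrite /S0 /complex_scale I_norm; congr (_ * _).
  have -> : (s * a) ^+ 2 + (s * - b) ^+ 2 = r^-1 ^+ 2.
    by rewrite exprVn r2 /s; field.
  by rewrite sqrtr_sqr ger0_norm // invr_ge0.
have S0_inv : is_bounded_inverse (complex_scale a b) S0.
  split; first by split=> //; exists r^-1 => v; rewrite S0_norm.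
  have comb x : complex_scale a b (S0 x) = x /\ S0 (complex_scale a b x) = x.
    rewrite /S0 /complex_scale !(linD I_lin) !(linZ I_lin) !II.
    split; apply: etrans (scale1r x).
      by rewrite -(mulVf ab0) -/s; module_over R V.
    by rewrite -(mulVf ab0) -/s; module_over R V.
  by split=> v; have [] := comb v.
have T_b : bounded_op T by split=> //; exists tau.
have [||||||||S SR SN] := @perturb_inverse R V (complex_scale a b) S0 (fun x => - T x) r^-1 tau.
- exact: cscale_lin.
- by move=> c x y; rewrite T_lin; module_over R V.
- exact: S0_inv.
- by rewrite invr_ge0.
- exact: tau_ge0.
- by move=> x; rewrite S0_norm.
- by move=> x; rewrite normrN.
- by rewrite mulrC ltr_pdivrMr // mul1r.
exists S; first exact: SR.
have NS := hidden_subspace I_lin P_lin P_bnd CP_ge0 I_norm T_b.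
have S_N v : hidden T (S0 v) -> hidden T (S v).
  apply: SN => // x Nx; apply: hidden_cscale => //.
  by apply: (subspaceN NS); exact: hidden_stable.
apply: (liftable_from P_lin NS (resolvent_lin SR)).
- exact: hidden_P.
- by move=> v Nv; apply: S_N; exact: hidden_cscale.
move=> v; rewrite (resolvent_comm v SR); apply: S_N; apply: hidden_cscale => //.
rewrite cscaleI (linB I_lin) (_ : _ - _ = T (I (S v)) - I (T (S v))).
  exact: hidden_comm.
by module_over R V.
Qed.

Lemma resolvent_large_bound a b S v : resolvent a b S ->
  `|S v| * (Num.sqrt (a ^+ 2 + b ^+ 2) - tau) <= `|v|.
Proof.
move=> [_ [_ AS]].
have : `|complex_scale a b (S v)| <= `|v| + `|T (S v)|.
  by rewrite -{2}(AS v) (le_trans _ (ler_normD _ _)) // subrK.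
rewrite /complex_scale I_norm mulrBr [_ * Num.sqrt _]mulrC lerBlDr => /le_trans; apply.
by rewrite lerD2l mulrC T_bnd.
Qed.

Lemma cscaleB a b a' b' x : complex_scale a b x = complex_scale a' b' x + complex_scale (a - a') (b - b') x.
Proof. by rewrite /complex_scale; module_over R V. Qed.

(** The perturbation is multiplication by the parameter increment, and the invariant subspace is now
    [hidden S0]. *)
Lemma resolvent_open a0 b0 : resolvent_set a0 b0 ->
  exists2 delta, 0 < delta & forall a b, `|a - a0| < delta -> `|b - b0| < delta ->
    resolvent_set a b.
Proof.
case=> S0 S0R S0_lift; have [S0_b [S0A A0S]] := S0R.
have [c c0 S0c] := bounded_op_gt0 S0_b; have [S0_lin _] := S0_b.
(* Half of 1/c per coordinate keeps the norm of the increment below 1/c. *)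
exists (c^-1 / 2) => [|a b ad bd]; first by rewrite divr_gt0 // invr_gt0.
pose D := complex_scale (a - a0) (b - b0).
pose A0 v := complex_scale a0 b0 v - T v.
have AE v : complex_scale a b v - T v = A0 v + D v.
  have -> : complex_scale a b v = complex_scale a0 b0 v + D v by exact: cscaleB.
  by rewrite /A0; module_over R V.
have A0_lin : linear A0.
  by move=> s x y; rewrite /A0 T_lin cscale_lin; module_over R V.
have [||||||||S SR0 SN] := @perturb_inverse R V A0 S0 D c (`|a - a0| + `|b - b0|).
- exact: A0_lin.
- exact: cscale_lin.
- exact: S0R.
- exact: ltW.
- by rewrite addr_ge0.
- exact: S0c.
- exact: cscale_bnd.
- by rewrite mulrC -ltr_pdivlMr // mul1r (splitr c^-1) ltrD.
have SR : resolvent a b S.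
  have [Sb [SA AS]] := SR0; split=> //; split=> v; rewrite AE; [exact: SA|exact: AS].
exists S => //.
have NS := hidden_subspace I_lin P_lin P_bnd CP_ge0 I_norm S0_b.
have S_N v : hidden S0 (S0 v) -> hidden S0 (S v).
  apply: SN => // x Nx; apply: hidden_stable; exact: hidden_cscale.
apply: (liftable_from P_lin NS (resolvent_lin SR)).
- exact: hidden_P.
- by move=> v Nv; apply: S_N; exact: hidden_stable.
move=> v; rewrite (resolvent_comm v SR) !AE; set z := S v.
have -> : I (A0 z + D z) - (A0 (I z) + D (I z)) = I (A0 z) - A0 (I z).
  by rewrite /D cscaleI (linD I_lin); module_over R V.
(* With w = A0 z, applying [S0] gives S0 (I w) - I (S0 w). *)
apply: S_N; rewrite (linB S0_lin) S0A -{2}(S0A z); exact: hidden_comm.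
Qed.

End Resolvent.

(** * Nonempty compact spectrum *)

Section FourPointMaximum.
Variable R : realType.

(* Adding [eps * (a ^ 2 + b ^ 2)] to [f] leaves no interior maximum: it raises the
   four-point mean by [eps * rho ^ 2], which beats the error [K * rho ^ 3]. *)
Lemma four_point_maximum (f : R -> R -> R) (r B : R) :
  continuous (fun p : R * R => f p.1 p.2) ->
  (forall a b, exists K r0, 0 < r0 /\ forall rho, 0 < rho < r0 ->
    4 * f a b <= f (a + rho) b + f (a - rho) b + f a (b + rho) + f a (b - rho)
      + K * rho ^+ 3) ->
  0 < r -> (forall a b, r ^+ 2 <= a ^+ 2 + b ^+ 2 -> f a b <= B) ->
  f 0 0 <= B.
Proof.
move=> f_cont f_mean r0 fB; apply/ler_addgt0Pl => eta eta0.
(* On the square a^2 + b^2 <= 2 r^2, so the added term is at most [eta]. *)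
pose eps := eta / (2 * r ^+ 2).
have r2 : 0 < r ^+ 2 by rewrite exprn_gt0.
have eps0 : 0 < eps by rewrite divr_gt0 // mulr_gt0.
have epsE : eps * (2 * r ^+ 2) = eta by rewrite /eps; field; rewrite gt_eqF.
pose G (p : R * R) := f p.1 p.2 + eps * (p.1 * p.1 + p.2 * p.2).
pose K := `[-r, r]%classic `*` `[-r, r]%classic : set (R * R).
have K_compact : compact K by apply: compact_setX; exact: segment_compact.
have G_cont : continuous G.
  move=> p; apply: cvgD; first exact: f_cont.
  apply: cvgM; first exact: cvg_cst.
  by apply: cvgD; apply: cvgM; first [exact: cvg_fst|exact: cvg_snd].
have K0 : K (0, 0) by rewrite /K /= !in_itv /= oppr_le0 ltW.
have [|[a b]] := compact_EVT_max _ K_compact (continuous_subspaceT G_cont).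
  by exists (0, 0).
rewrite inE /K /= !in_itv /= => -[/andP[a1 a2] /andP[b1 b2]] Gmax.
have G0 : f 0 0 <= G (a, b).
  by have := Gmax (0, 0) (mem_set K0); rewrite /G /= !mulr0 addr0 mulr0 addr0.
(* A maximiser outside the open disc is controlled by [B]; one inside it is interior to the square
   and contradicts the four-point inequality. *)
have [ab|ab] := leP (r ^+ 2) (a ^+ 2 + b ^+ 2).
  have := fB _ _ ab; move: G0; rewrite /G /= -epsE.
  have : a * a <= r ^+ 2 by nra.
  have : b * b <= r ^+ 2 by nra.
  nra.
exfalso.
have ar : - r < a < r by apply/andP; nra.
have br : - r < b < r by apply/andP; nra.
have [k [s [s0 f4]]] := f_mean a b.
(* Below [m] the mean inequality is valid, k rho stays under [eps], and the four neighbours remain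
   in the square. *)
pose m := Num.min (Num.min s (eps / (`|k| + 1))) (Num.min (Num.min (r - a) (a + r)) (Num.min (r - b) (b + r))).
have k1 : 0 < `|k| + 1 by rewrite ltr_wpDl.
have m0 : 0 < m.
  by case/andP: ar => ? ?; case/andP: br => ? ?; rewrite !lt_min s0 divr_gt0 //= !subr_gt0 -!ltrBlDr !sub0r; do !(apply/andP; split).
pose rho := m / 2.
have rho0 : 0 < rho by rewrite divr_gt0.
have : rho < m by rewrite /rho; lra.
rewrite /m !lt_min => /andP[/andP[rho_s rho_k] /andP[/andP[? ?] /andP[? ?]]].
have {f4} := f4 rho; rewrite rho0 rho_s => /(_ isT).
have GK x y : - r <= x <= r -> - r <= y <= r -> G (x, y) <= G (a, b).
  by move=> xr yr; apply: Gmax; rewrite inE /K /= !in_itv /= xr yr.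
have := GK (a + rho) b; have := GK (a - rho) b.
have := GK a (b + rho); have := GK a (b - rho).
rewrite /G /= a1 a2 b1 b2.
do 4 (move/(_ ltac:(by apply/andP; lra) ltac:(by apply/andP; lra)) => ?).
have : k * rho ^+ 3 < eps * rho ^+ 2.
  rewrite exprS mulrA ltr_pM2r ?exprn_gt0 //.
  move: rho_k; rewrite ltr_pdivlMr //; have := ler_norm k; nra.
nra.
Qed.

End FourPointMaximum.

(** * Second-order expansion of the resolvent *)

Section ResolventNeverEntire.
Variables (R : realType) (V : completeNormedModType R) (I P T : V -> V) (CP tau : R).
Hypothesis I_lin : linear I.
Hypothesis II : forall x, I (I x) = - x.
Hypothesis I_norm :
  forall a b x, `|a *: x + b *: I x| = Num.sqrt (a ^+ 2 + b ^+ 2) * `|x|.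
Hypothesis P_lin : linear P.
Hypothesis CP_ge0 : 0 <= CP.
Hypothesis P_bnd : forall x, `|P x| <= CP * `|x|.
Hypothesis T_lin : linear T.
Hypothesis tau_ge0 : 0 <= tau.
Hypothesis T_bnd : forall x, `|T x| <= tau * `|x|.

Local Notation cscale := (complex_scale I).
Local Notation resolvent := (resolvent I T).
Local Notation liftable := (liftable I P).

(** The resolvent identity; the increment stays between the two inverses, since neither has to
    commute with I. *)
Lemma resolvent_diff a b a0 b0 S S0 v : resolvent a b S -> resolvent a0 b0 S0 ->
  S v = S0 v - S0 (cscale (a - a0) (b - b0) (S v)).
Proof.
move=> SR S0R; have S0_lin := resolvent_lin S0R.
have [_ [_ AS]] := SR; have [_ [S0A _]] := S0R.
rewrite -{2}(AS v) (cscaleB I a b a0 b0) addrAC (linD S0_lin) S0A.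
by rewrite addrK.
Qed.

Lemma resolvent_near_bound a b a0 b0 S S0 c v : resolvent a b S ->
  resolvent a0 b0 S0 -> (forall x, `|S0 x| <= c * `|x|) -> 0 < c ->
  (forall x, `|cscale (a - a0) (b - b0) x| <= (2 * c)^-1 * `|x|) ->
  `|S v| <= 2 * c * `|v|.
Proof.
move=> SR S0R S0c c0 Dc.
have : `|S v| <= `|S0 v| + `|S0 (cscale (a - a0) (b - b0) (S v))|.
  by rewrite {1}(resolvent_diff v SR S0R) ler_normB.
have := S0c v; have := S0c (cscale (a - a0) (b - b0) (S v)).
have := Dc (S v).
rewrite -(ler_pM2l c0) mulrA invfM mulrCA mulfV ?gt_eqF // mulr1; lra.
Qed.

(** Three uses of the resolvent identity leave the remainder - S0 D S0 D S0 D S; the last factor is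
    bounded by 2 c. *)
Lemma resolvent_expand a b a0 b0 S S0 D c rho v : resolvent a b S ->
  resolvent a0 b0 S0 -> (forall x, `|S0 x| <= c * `|x|) -> 0 < c ->
  linear D -> (forall x, cscale (a - a0) (b - b0) x = D x) ->
  (forall x, `|D x| <= rho * `|x|) -> 0 <= rho -> rho <= (2 * c)^-1 ->
  `|P (S v) - (P (S0 v) - P (S0 (D (S0 v))) + P (S0 (D (S0 (D (S0 v))))))|
    <= CP * (2 * c ^+ 4 * rho ^+ 3 * `|v|).
Proof.
move=> SR S0R S0c c0 D_lin DE Drho rho0 rho_c; have S0_lin := resolvent_lin S0R.
have E x : S x = S0 x - S0 (D (S x)) by rewrite -DE; exact: resolvent_diff.
have Sc : `|S v| <= 2 * c * `|v|.
  apply: resolvent_near_bound SR S0R S0c c0 _ => x.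
  by rewrite DE (le_trans (Drho x)) // ler_wpM2r.
rewrite -(linB P_lin) -!(linD P_lin) -(linB P_lin).
set w := (X in `|P X|).
have -> : w = - S0 (D (S0 (D (S0 (D (S v)))))).
  rewrite /w {1}E {1}E !(linB D_lin, linB S0_lin) {1}E.
  by rewrite !(linB D_lin, linB S0_lin); module_over R V.
rewrite (le_trans (P_bnd _)) // ler_wpM2l // normrN.
have S0D x y : `|x| <= y -> `|S0 (D x)| <= c * rho * y.
  move=> xy; rewrite (le_trans (S0c _)) // -mulrA ler_wpM2l ?(ltW c0) //.
  by rewrite (le_trans (Drho _)) // ler_wpM2l.
have -> : 2 * c ^+ 4 * rho ^+ 3 * `|v| =
  c * rho * (c * rho * (c * rho * (2 * c * `|v|))) by ring.
by do 3!apply: (S0D _ _).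
Qed.

(** Over the four increments the linear terms cancel by sign, and the quadratic ones cancel under P
    by [quad], a discrete form of harmonicity. *)
Lemma four_point_resolvent a0 b0 S0 S1 S2 S3 S4 c rho v :
  resolvent a0 b0 S0 -> liftable S0 ->
  resolvent (a0 + rho) b0 S1 -> resolvent (a0 - rho) b0 S2 ->
  resolvent a0 (b0 + rho) S3 -> resolvent a0 (b0 - rho) S4 ->
  (forall x, `|S0 x| <= c * `|x|) -> 0 < c -> 0 <= rho -> rho <= (2 * c)^-1 ->
  4 * `|P (S0 v)| <= `|P (S1 v)| + `|P (S2 v)| + `|P (S3 v)| + `|P (S4 v)|
    + 4 * (CP * (2 * c ^+ 4 * rho ^+ 3 * `|v|)).
Proof.
move=> S0R S0_lift S1R S2R S3R S4R S0c c0 rho0 rho_c.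
have S0_lin := resolvent_lin S0R.
set err := CP * _.
(* Liftability for n = 1 brings the left I out to P, and for n = 2 puts it back next to the other
   I. *)
have quad x : P (S0 (I (S0 (I (S0 x))))) = - P (S0 (S0 (S0 x))).
  have /= -> := S0_lift 1%N (S0 (I (S0 x))).
  have /= <- := S0_lift 2%N (I (S0 x)).
  by rewrite II !(linN S0_lin) (linN P_lin).
pose y (D : V -> V) := P (S0 v) - P (S0 (D (S0 v))) + P (S0 (D (S0 (D (S0 v))))).
have bnd a b S D : resolvent a b S -> linear D ->
    (forall x, cscale (a - a0) (b - b0) x = D x) ->
    (forall x, `|D x| <= rho * `|x|) ->
    `|y D| <= `|P (S v)| + err.
  move=> SR D_lin DE Drho.
  have := resolvent_expand v SR S0R S0c c0 D_lin DE Drho rho0 rho_c.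
  rewrite -/(y D) => h.
  have -> : y D = P (S v) - (P (S v) - y D) by rewrite subKr.
  by rewrite (le_trans (ler_normB _ _)) // lerD2l.
have sI s : linear (fun x => s *: I x).
  by move=> a x z; rewrite I_lin; module_over R V.
have sid s : linear (fun x : V => s *: x).
  by move=> a x z; module_over R V.
have rn : `|rho| = rho by exact: ger0_norm.
have h1 : `|y (fun x => rho *: x)| <= `|P (S1 v)| + err.
  apply: (bnd _ _ _ _ S1R (sid _)) => x; last by rewrite normrZ rn.
  by rewrite /complex_scale; module_over R V.
have h2 : `|y (fun x => (- rho) *: x)| <= `|P (S2 v)| + err.
  apply: (bnd _ _ _ _ S2R (sid _)) => x; last by rewrite normrZ normrN rn.
  by rewrite /complex_scale; module_over R V.
have h3 : `|y (fun x => rho *: I x)| <= `|P (S3 v)| + err.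
  apply: (bnd _ _ _ _ S3R (sI _)) => x; last by rewrite normrZ (I_isom I_norm) rn.
  by rewrite /complex_scale; module_over R V.
have h4 : `|y (fun x => (- rho) *: I x)| <= `|P (S4 v)| + err.
  apply: (bnd _ _ _ _ S4R (sI _)) => x; last by rewrite normrZ normrN (I_isom I_norm) rn.
  by rewrite /complex_scale; module_over R V.
have sum4 : 4 *: P (S0 v) = y (fun x => rho *: x) + y (fun x => (- rho) *: x)
    + y (fun x => rho *: I x) + y (fun x => (- rho) *: I x).
  rewrite /y !(linZ I_lin, linZ S0_lin, linZ P_lin) quad.
  by module_over R V.
have -> : 4 * `|P (S0 v)| = `|4 *: P (S0 v)| by rewrite normrZ ger0_norm.
rewrite sum4.
have := ler_normD (y (fun x => rho *: x) + y (fun x => (- rho) *: x)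
    + y (fun x => rho *: I x)) (y (fun x => (- rho) *: I x)).
have := ler_normD (y (fun x => rho *: x) + y (fun x => (- rho) *: x))
   (y (fun x => rho *: I x)).
have := ler_normD (y (fun x => rho *: x)) (y (fun x => (- rho) *: x)).
lra.
Qed.

End ResolventNeverEntire.

(** * Nonemptiness by the maximum principle *)

Section SpectrumNonempty.
Variables (R : realType) (V : completeNormedModType R) (I P T : V -> V) (CP tau : R).
Hypothesis I_lin : linear I.
Hypothesis II : forall x, I (I x) = - x.
Hypothesis I_norm :
  forall a b x, `|a *: x + b *: I x| = Num.sqrt (a ^+ 2 + b ^+ 2) * `|x|.
Hypothesis P_lin : linear P.
Hypothesis CP_ge0 : 0 <= CP.
Hypothesis P_bnd : forall x, `|P x| <= CP * `|x|.
Hypothesis T_lin : linear T.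
Hypothesis tau_ge0 : 0 <= tau.
Hypothesis T_bnd : forall x, `|T x| <= tau * `|x|.

Local Notation cscale := (complex_scale I).
Local Notation resolvent := (resolvent I T).
Local Notation liftable := (liftable I P).

Lemma resolvent_continuous (S : R -> R -> V -> V) v :
  (forall a b, resolvent a b (S a b)) ->
  continuous (fun p : R * R => `|P (S p.1 p.2 v)|).
Proof.
move=> SR p; apply/cvgrPdist_lt => eta eta0.
have [S0_b _] := SR p.1 p.2; have [c c0 S0c] := bounded_op_gt0 S0_b.
pose M := CP * (c * (2 * (2 * c * `|v|))).
have M0 : 0 <= M by rewrite !mulr_ge0 // ltW.
(* The first bound makes [resolvent_near_bound] applicable; the second makes the variation, at most
   [M * (d / 2)] with d < 2 delta, smaller than [eta]. *)
pose delta := Num.min ((2 * c)^-1 / 2) (eta / (M + 1)).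
have delta0 : 0 < delta by rewrite lt_min !divr_gt0 ?invr_gt0 ?mulr_gt0 // ltr_wpDl.
exists (ball p.1 delta, ball p.2 delta).
  by split; exact: nbhsx_ballx.
move=> q [/= d1 d2].
pose d := `|q.1 - p.1| + `|q.2 - p.2|.
have [d1c d1M] : `|q.1 - p.1| < (2 * c)^-1 / 2 /\ `|q.1 - p.1| < eta / (M + 1).
  by move: d1; rewrite -ball_normE /= distrC lt_min => /andP.
have [d2c d2M] : `|q.2 - p.2| < (2 * c)^-1 / 2 /\ `|q.2 - p.2| < eta / (M + 1).
  by move: d2; rewrite -ball_normE /= distrC lt_min => /andP.
have Dd x : `|cscale (q.1 - p.1) (q.2 - p.2) x| <= d * `|x|.
  exact: (cscale_bnd I_norm).
have Sc : `|S q.1 q.2 v| <= 2 * c * `|v|.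
  apply: (resolvent_near_bound v (SR _ _) (SR p.1 p.2) S0c c0) => x.
  by rewrite (le_trans (Dd x)) // ler_wpM2r // /d; lra.
have diff := resolvent_diff v (SR q.1 q.2) (SR p.1 p.2).
apply: (@le_lt_trans _ _ `|P (S p.1 p.2 v) - P (S q.1 q.2 v)|).
  exact: ler_dist_dist.
rewrite -(linB P_lin) diff subKr.
apply: (@le_lt_trans _ _ (CP * (c * (d * (2 * c * `|v|))))).
  rewrite (le_trans (P_bnd _)) // ler_wpM2l // (le_trans (S0c _)) // ler_wpM2l ?(ltW c0) //.
  by apply: (le_trans (Dd _)); rewrite ler_wpM2l // addr_ge0.
have -> : CP * (c * (d * (2 * c * `|v|))) = M * (d / 2) by rewrite /M; field.
have M1 : 0 < M + 1 by rewrite ltr_wpDl.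
move: d1M d2M; rewrite !ltr_pdivlMr // => d1M d2M.
have : d * (M + 1) < 2 * eta by rewrite mulrDl /d mulrDl; lra.
have : 0 <= d by rewrite addr_ge0.
nra.
Qed.

Lemma resolvent_set_entire_trivial :
  (forall a b, resolvent_set I P T a b) -> forall w, P w = 0.
Proof.
move=> all_res w.
have ex a b : {S | resolvent a b S /\ liftable S}.
  apply: constructive_indefinite_description.
  by have [S SR S_lift] := all_res a b; exists S.
pose S a b := sval (ex a b).
have SR a b : resolvent a b (S a b) by have [] := svalP (ex a b).
have S_lift a b : liftable (S a b) by have [] := svalP (ex a b).
(* Every [w] is in the range of the inverse at 0. *)
suff PS0 v : P (S 0 0 v) = 0.
  have [_ [SA _]] := SR 0 0.
  by rewrite -(SA w) PS0.
apply/eqP; rewrite -normr_le0; apply/ler_addgt0Pl => eta eta0; rewrite addr0.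
(* Chosen so that CP |v| / (r - tau) <= eta, which bounds the function by [eta] off the disc. *)
pose r := tau + 1 + CP * `|v| / eta.
have CPv : 0 <= CP * `|v| / eta by rewrite !mulr_ge0 // invr_ge0 ltW.
have r_gt : tau + 1 <= r by rewrite lerDl.
have r0 : 0 < r by rewrite (lt_le_trans _ r_gt) // ltr_wpDl.
apply: (four_point_maximum (f := fun a b => `|P (S a b v)|) (r := r)) => //.
- exact: resolvent_continuous.
- move=> a b.
  have [S0_b _] := SR a b; have [c c0 S0c] := bounded_op_gt0 S0_b.
  exists (4 * (CP * (2 * c ^+ 4 * `|v|))), (2 * c)^-1.
  split; first by rewrite invr_gt0 mulr_gt0.
  move=> rho /andP[rho0 rho_c].
  have := four_point_resolvent I_lin II I_norm P_lin CP_ge0 P_bnd v (SR a b) (S_lift a b)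
    (SR (a + rho) b) (SR (a - rho) b) (SR a (b + rho)) (SR a (b - rho)) S0c c0
    (ltW rho0) (ltW rho_c).
  move=> h; rewrite (le_trans h) // lerD2l le_eqVlt; apply/orP; left.
  by apply/eqP; ring.
- move=> a b rab.
  have r_le : r <= Num.sqrt (a ^+ 2 + b ^+ 2).
    by rewrite -[r]gtr0_norm // -sqrtr_sqr ler_wsqrtr.
  have h := resolvent_large_bound I_norm T_bnd v (SR a b).
  apply: (le_trans (P_bnd _)).
  have eta_r : CP * `|v| <= eta * (r - tau).
    have r_tau' : CP * `|v| / eta <= r - tau by rewrite /r; lra.
    rewrite -ler_pdivrMl //; have -> : eta^-1 * (CP * `|v|) = CP * `|v| / eta by ring.
    exact: r_tau'.
  have s0 := normr_ge0 (S a b v).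
  have h2 : `|S a b v| * (r - tau) <= `|v|.
    by rewrite (le_trans _ h) // ler_wpM2l // lerD2r.
  have rt : 0 < r - tau by rewrite subr_gt0 (lt_le_trans _ r_gt) // ltrDl.
  rewrite -(ler_pM2r rt) -mulrA (le_trans _ eta_r) // ler_wpM2l //.
Qed.

End SpectrumNonempty.

(** * Compactness in the parameter plane *)

Section SpectrumCompact.
Variables (R : realType) (V : completeNormedModType R) (I P T : V -> V) (CP tau : R).
Hypothesis I_lin : linear I.
Hypothesis II : forall x, I (I x) = - x.
Hypothesis I_norm :
  forall a b x, `|a *: x + b *: I x| = Num.sqrt (a ^+ 2 + b ^+ 2) * `|x|.
Hypothesis P_lin : linear P.
Hypothesis CP_ge0 : 0 <= CP.
Hypothesis P_bnd : forall x, `|P x| <= CP * `|x|.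
Hypothesis T_lin : linear T.
Hypothesis tau_ge0 : 0 <= tau.
Hypothesis T_bnd : forall x, `|T x| <= tau * `|x|.
Hypothesis T_lift : liftable I P T.

Lemma spectrum_compact :
  compact [set p : R * R | ~ resolvent_set I P T p.1 p.2].
Proof.
set A := (X in compact X).
have A_closed : closed A.
  rewrite -openC; rewrite openE => p /= /contrapT /(resolvent_open I_lin II I_norm P_lin CP_ge0 P_bnd T_lin)[d d0 dP].
  exists (ball p.1 d, ball p.2 d); first by split; exact: nbhsx_ballx.
  move=> q [/= q1 q2]; apply; apply: dP.
    by move: q1; rewrite -ball_normE /= distrC.
  by move: q2; rewrite -ball_normE /= distrC.
pose K := `[-tau, tau]%classic `*` `[-tau, tau]%classic : set (R * R).
apply: (@subclosed_compact _ A K) => //.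
  by apply: compact_setX; exact: segment_compact.
move=> -[a b] /= nres; rewrite /K /= !in_itv /= -!ler_norml.
have le_tau : a ^+ 2 + b ^+ 2 <= tau ^+ 2.
  rewrite leNgt; apply/negP => lt_tau; apply: nres.
  exact: (resolvent_large I_lin II I_norm P_lin CP_ge0 P_bnd T_lin tau_ge0).
have := sqr_ge0 a; have := sqr_ge0 b.
by split; rewrite -(ler_pXn2r (n := 2)) ?nnegrE // real_normK ?num_real //; lra.
Qed.

End SpectrumCompact.

(** * Specialisation to right multiplication by J and the real part *)

Section PushForwardSpectrum.
Variables (R : realType) (V : completeNormedModType R).
Variables (lm : oct R -> V -> V) (rm : V -> oct R -> V).
Hypothesis VB : is_BanachObimodule lm rm.
Variables (J : oct R).
Hypothesis J_unit : oimag_units J.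

Local Notation one := (oone R).
Local Notation I := (fun v : V => rm v J).
Local Notation Rp := (re_proj lm).

Let VO : is_Obimodule lm rm. Proof. by case: VB. Qed.
Let rm_lin p : linear (fun x => rm x p). Proof. by case: VO => _ [] _ []. Qed.
Let rmr_lin x : linear (rm x). Proof. by case: VO => _ [] _ [] _ []. Qed.

Lemma rm_CJ a b v : rm v (a *: one + b *: J) = complex_scale I a b v.
Proof. by rewrite (rmr_lin v) (linZ (rmr_lin v)) (rm1 VO). Qed.

Lemma rm_J_sqr v : rm (rm v J) J = - v.
Proof. exact: rm_sqr VO _ _ J_unit. Qed.

Lemma rm_J_norm a b v :
  `|a *: v + b *: rm v J| = Num.sqrt (a ^+ 2 + b ^+ 2) * `|v|.
Proof.
rewrite -/(complex_scale I a b v) -rm_CJ; have [_ /(_ (a *: one + b *: J) v)[_ ->]] := VB.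
by rewrite onorm_CJ.
Qed.

Lemma CJ_liftableP S : linear S ->
  CJ_liftable_power_assoc lm rm J S <-> liftable I Rp S.
Proof.
move=> S_lin; split=> [SJ n v|SI n n1 v lam [a [b ->]]].
  case: n => [//|n]; rewrite -!(ReV_Rp VO); apply: SJ => //.
  by exists 0, 1; rewrite scale0r add0r scale1r.
rewrite !(ReV_Rp VO) !rm_CJ /complex_scale (iter_lin n S_lin) (linZ (iter_lin n S_lin)).
by rewrite !(linD (Rp_lin VO)) !(linZ (Rp_lin VO)) SI.
Qed.

Lemma rhoJP T a b : rhoJ lm rm T J (a *: one + b *: J) <-> resolvent_set I Rp T a b.
Proof.
have -> : rhoJ lm rm T J (a *: one + b *: J) <-> exists S : V -> V,
    resolvent I T a b S /\ CJ_liftable_power_assoc lm rm J S.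
  rewrite /rhoJ /=; have -> : (fun v => Rmul rm (a *: one + b *: J) v - T v) =
      (fun v => complex_scale I a b v - T v).
    by apply/funext => v; rewrite /Rmul rm_CJ.
  by split=> [[_]//|S_ex]; split=> //; exists a, b.
split=> [[S [SR SJ]]|[S SR SI]]; exists S => //.
  by apply/(CJ_liftableP (resolvent_lin SR)).
by split=> //; apply/(CJ_liftableP (resolvent_lin SR)).
Qed.

Lemma power_associative_liftable T : power_associative lm rm T -> liftable I Rp T.
Proof.
move=> Tpa n v; have [_ /(_ J v)] := Tpa n.
by rewrite (ReV_Rp VO) (linB (Rp_lin VO)) => /eqP; rewrite subr_eq0 => /eqP ->.
Qed.

End PushForwardSpectrum.

(** * The operator norm bounds the operator *)

Section OperatorNorm.
Variables (R : realType) (V : completeNormedModType R) (T : V -> V).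
Hypothesis T_b : bounded_op T.

Let T_ub : has_ubound [set `|T v| | v in [set v : V | `|v| <= 1]].
Proof.
have [C C0 TC] := bounded_op_gt0 T_b; exists C => _ [v /= v1 <-].
by rewrite (le_trans (TC v)) // ler_piMr // ltW.
Qed.

Lemma opnorm_ge0 : 0 <= opnorm T.
Proof.
have [T_lin _] := T_b; apply: (ub_le_sup T_ub); exists 0; rewrite /= ?normr0 //.
by rewrite (lin0 T_lin) normr0.
Qed.

Lemma opnorm_bound v : `|T v| <= opnorm T * `|v|.
Proof.
have [T_lin _] := T_b.
have [->|v0] := eqVneq v 0; first by rewrite (lin0 T_lin) normr0 mulr0.
have nv : 0 < `|v| by rewrite normr_gt0.
rewrite -ler_pdivrMr //; apply: (ub_le_sup T_ub).
exists (`|v|^-1 *: v) => /=; rewrite ?(linZ T_lin) normrZ ger0_norm ?invr_ge0 //.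
  by rewrite mulVf // gt_eqF.
by rewrite mulrC.
Qed.

End OperatorNorm.

Unset Implicit Arguments.

Theorem mainTheorem11 (R : realType) (V : completeNormedModType R)
  (lm : oct R -> V -> V) (rm : V -> oct R -> V)
  (HV : is_BanachObimodule lm rm)
  (Hnz : exists v : V, v != 0)
  (T : V -> V)
  (HT : is_RO lm rm T)
  (HTpa : power_associative lm rm T) :
  (forall s : oct R, opnorm T < onorm s ->
     rho_star lm rm T s /\
     (forall J : oct R, oimag_units J -> oCJ J s -> rhoJ lm rm T J s)) /\
  (forall J : oct R, oimag_units J ->
     sigmaJ lm rm T J !=set0 /\ compact (sigmaJ lm rm T J)).
Proof.
have [VO _] := HV; have [T_b _] := HT; have [T_lin _] := T_b.
have [CP CP0 P_bnd] := Rp_bounded HV.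
have rmJ_lin (J : oct R) : linear (fun v : V => rm v J).
  by case: VO => _ [] _ [].
have large (s : oct R) (J : oct R) : opnorm T < onorm s ->
    oimag_units J -> oCJ J s -> rhoJ lm rm T J s.
  move=> lt_s JJ [a [b sE]]; rewrite sE; apply/(rhoJP HV J).
  apply: (resolvent_large (rmJ_lin J) (rm_J_sqr HV JJ) (rm_J_norm HV JJ)
    (Rp_lin VO) CP0 P_bnd T_lin (opnorm_ge0 T_b) (opnorm_bound T_b)).
    exact: power_associative_liftable.
  move: lt_s; rewrite sE onorm_CJ // => lt_s.
  rewrite -(@sqr_sqrtr _ (a ^+ 2 + b ^+ 2)) ?addr_ge0 ?sqr_ge0 //.
  by rewrite ltr_pXn2r // nnegrE ?opnorm_ge0 ?sqrtr_ge0.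
split=> [s lt_s|J JJ].
  split; last by move=> J; exact: large.
  by have [J JJ sJ] := oct_in_CJ s; exists J; split=> //; exact: large.
have lift : liftable (fun v : V => rm v J) (re_proj lm) T.
  exact: power_associative_liftable.
split.
  (* An empty spectrum would make every real part vanish, hence V = 0. *)
  apply: contrapT => no_spec.
  have [v v0] := Hnz; move/eqP: v0; apply.
  apply: (Rp_trivial VO) => x.
  apply: (resolvent_set_entire_trivial (rmJ_lin J) (rm_J_sqr HV JJ) (rm_J_norm HV JJ)
    (Rp_lin VO) CP0 P_bnd (opnorm_ge0 T_b) (opnorm_bound T_b)) => a b.
  apply/(rhoJP HV J); apply: contrapT => nrho; apply: no_spec.
  by exists (a *: oone R + b *: J); split=> //; exists a, b.
(* Compactness passes from the parameter plane to C_J through the continuous map (a, b) -> a + b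
   J. *)
have -> : sigmaJ lm rm T J = (fun p : R * R => p.1 *: oone R + p.2 *: J) @`
    [set p | ~ resolvent_set (fun v : V => rm v J) (re_proj lm) T p.1 p.2].
  apply/seteqP; split=> [s [[a [b sE]] nrho]|_ [[a b] /= nres <-]].
    by exists (a, b) => //=; rewrite sE in nrho => res; apply: nrho; apply/(rhoJP HV J).
  by split; [exists a, b|move/(rhoJP HV J)].
apply: continuous_compact; last first.
  exact: (spectrum_compact (rmJ_lin J) (rm_J_sqr HV JJ) (rm_J_norm HV JJ)
    (Rp_lin VO) CP0 P_bnd T_lin (opnorm_ge0 T_b) (opnorm_bound T_b) lift).
apply: continuous_subspaceT => p.
by apply: cvgD; apply: cvgZl; [exact: cvg_fst|exact: cvg_snd].
Qed.
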